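(* For each positive integer $k$ there exist $\mathcal C_k$ and $\mathcal D_k$ so that $$2p^k(n) < \left( p^k(n+1) + p^k(n-1)\right)\left( 1- n^{-2}\right) \qquad \text{for all integers } n\geqslant \mathcal C_k,$$ $$p^k(n)^2 > p^k(n+1) \cdot p^k(n-1) \cdot \left( 1+n^{-2}\right) \qquad \text{for all integers } n\geqslant \mathcal D_k.$$
   Context: For a positive integer $k$, $p^k(n)$ denotes the number of partitions of the integer $n$ into (positive) $k$th powers; its generating function is $\sum_{n=0}^\infty p^k(n) q^n = \prod_{m=1}^\infty \frac 1{1-q^{m^k}}$. (The superscript $k$ is not an exponent; $p^k(n)^2$ means $(p^k(n))^2$.) *)

(* Defs.v *)
From mathcomp Require Import all_boot.

Set Implicit Arguments.
Unset Strict Implicit.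
Unset Printing Implicit Defensive.

(* Partitions are nonincreasing sequences of positive integers. *)
Definition is_partition (n : nat) (s : seq nat) : bool :=
  [&& sorted geq s, all (leq 1) s & sumn s == n].

Definition is_pos_power (k a : nat) : bool :=
  [exists m : 'I_a.+1, (0 < m) && (m ^ k == a)].

Definition is_power_partition (k n : nat) (s : seq nat) : bool :=
  is_partition n s && all (is_pos_power k) s.

(* A partition of n has at most n parts, each at most n, so all of them live in
   the finite type of sequences of length at most n over {0, ..., n}; see
   [num_power_partitionsE]. *)
Definition num_power_partitions (k n : nat) : nat :=
  #|[set s : n.-bseq 'I_n.+1 | is_power_partition k n (map val s)]|.

Lemma is_pos_powerP (k a : nat) : 0 < k ->
  reflect (exists2 m, 0 < m & a = m ^ k) (is_pos_power k a).
Proof.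
move=> k0; apply: (iffP existsP) => [[m /andP[m0 /eqP <-]]|[m m0 ->]].
  by exists (m : nat).
have le : m <= m ^ k by rewrite -{1}(expn1 m) leq_pexp2l.
by exists (Ordinal (le : m < (m ^ k).+1)); rewrite /= m0 eqxx.
Qed.

Lemma partition_bseq (n : nat) (s : seq nat) :
  is_partition n s -> exists t : n.-bseq 'I_n.+1, map val t = s.
Proof.
case/and3P=> _ pos /eqP sn.
have size_s : size s <= n.
  rewrite -sn; elim: s pos {sn} => //= a s IH /andP[a0 /IH le].
  by rewrite -add1n leq_add.
have bound : all (fun a => a < n.+1) s.
  rewrite -sn; elim: s {pos sn size_s} => //= a s IH.
  rewrite ltnS leq_addr /=; apply: sub_all IH => b; rewrite !ltnS => le.
  exact: leq_trans le (leq_addl _ _).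
have E : map val (pmap insub s : seq 'I_n.+1) = s.
  rewrite (pmap_filter (insubK _)); apply/all_filterP; apply: sub_all bound.
  by move=> a; rewrite isSome_insub.
have size_t : size (pmap insub s : seq 'I_n.+1) <= n.
  by rewrite -(size_map val) E.
by exists (Bseq size_t).
Qed.

Lemma num_power_partitionsE (k n : nat) (l : seq (seq nat)) :
  uniq l -> (forall s, (s \in l) = is_power_partition k n s) ->
  num_power_partitions k n = size l.
Proof.
move=> Ul memE.
have inj : injective (fun s : n.-bseq 'I_n.+1 => map val s).
  by move=> s t /(inj_map val_inj) /val_inj.
rewrite /num_power_partitions cardE.
rewrite -(size_map (fun s : n.-bseq 'I_n.+1 => map val s)).
apply/perm_size/uniq_perm => //; first by rewrite map_inj_uniq ?enum_uniq.
move=> s; rewrite memE; apply/mapP/idP => [[t]|ps].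
  by rewrite mem_enum inE => pt ->.
have [t tE] := partition_bseq (proj1 (andP ps)).
by exists t; rewrite // mem_enum inE tE.
Qed.

(* Main.v *)
(* Write [r_m = exp (- m^k x)] and let [x] be the saddle point, [n = sum m^k r_m / (1 - r_m)].
   The Fourier integrals of [prod (1 - r_m) / (1 - r_m exp (i m^k t)) = A exp (i (psi + n t))]
   at [n], [n + 1], [n - 1] are [a], [a - b + s], [a - b - s], where
     a = int A cos psi,   b = int A cos psi (1 - cos t),   s = int A sin psi sin t,
   and up to a common factor they equal [p(n)], [exp (- x) p(n + 1)], [exp x p(n - 1)].
   So [p(n)^2 - p(n + 1) p(n - 1)] is proportional to [2 a b - b^2 + s^2], where the sign of [s^2]
   is favourable: only [b] has to be bounded below, by about [x^(2 + 1/k) a], which dominates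
   [a / n^2].  Convexity follows from [cosh x >= 1 + x^2 / 8] once [b] and [x |s|] are small
   compared to [x^2 a].  All this needs only crude bounds: [psi] is small for [|t| <= eta], [A]
   is bounded below for [|t| <= zeta], and [A] is negligible for [|t| >= eta].  The last one
   rests on an elementary lower bound for [sum (1 - cos (m^k t))]. *)

From Stdlib Require Import Reals Lra Lia ZArith Arith.
From mathcomp Require Import ssreflect.
From Coquelicot Require Import Coquelicot.

(** With [X = x^(-1/k)], the argument differs from its linear part by at most about [X (t X^k)^3],
    and [- ln A] is at most about [X (t X^k)^2]. This dictates the two widths: [eta] of order
    [x X^(-1/3)] and [zeta] of order [x X^(-1/2)]. No asymptotics of the integrals are needed: [a]
    is at most of order [eta], [b] at least of order [zeta^3], and [n >= X^(k+1) / 8], so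
    [n^2 b / a] is at least of order [X^(5/6)], a slack that pays for all constants. Beyond [eta]
    the bound for [A] is [exp (- c X^(1/3))], smaller than any power of [X]. The obstacle is to have
    this bound for all [t] up to [pi], also near rational multiples of [2 pi]. It asks for many [m]
    with [m^k t] away from [2 pi Z], not for cancellation; so the single denominator [k!] replaces a
    Farey dissection, because k-th differences of [m^k t] with step [h] are the constant [k! h^k t].
    The product is cut at [N = n + 1] for all three values at once: no partition of [n + 1] is lost,
    and the common factor is the same. *)

Local Open Scope R_scope.

(* The index runs over [1, ..., N]; the same holds for [rprod] below. *)
Fixpoint rsum (f : nat -> R) (N : nat) : R :=
  match N with O => 0 | S N' => rsum f N' + f N end.

Lemma rsum_ext (f g : nat -> R) (N : nat) :
  (forall m, (1 <= m <= N)%nat -> f m = g m) -> rsum f N = rsum g N.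
Proof.
  elim: N => [//|N IH] H /=; rewrite IH; last by move=> m Hm; apply: H; lia.
  by rewrite H //; lia.
Qed.

Lemma rsum_le (f g : nat -> R) (N : nat) :
  (forall m, (1 <= m <= N)%nat -> f m <= g m) -> rsum f N <= rsum g N.
Proof.
  elim: N => [|N IH] H /=; first lra.
  apply: Rplus_le_compat; last by apply: H; lia.
  by apply: IH => m Hm; apply: H; lia.
Qed.

Lemma rsum_scal (c : R) (f : nat -> R) (N : nat) :
  rsum (fun m => c * f m) N = c * rsum f N.
Proof. by elim: N => [|N IH] /=; rewrite ?IH; ring. Qed.

Lemma rsum_plus (f g : nat -> R) (N : nat) :
  rsum (fun m => f m + g m) N = rsum f N + rsum g N.
Proof. by elim: N => [|N IH] /=; rewrite ?IH; ring. Qed.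

Lemma rsum_minus (f g : nat -> R) (N : nat) :
  rsum (fun m => f m - g m) N = rsum f N - rsum g N.
Proof. by elim: N => [|N IH] /=; rewrite ?IH; ring. Qed.

Lemma rsum_const (c : R) (N : nat) : rsum (fun _ => c) N = INR N * c.
Proof. elim: N => [|N IH]; first by rewrite /=; ring. by rewrite S_INR /= IH; ring. Qed.

Lemma rsum_ge0 (f : nat -> R) (N : nat) :
  (forall m, (1 <= m <= N)%nat -> 0 <= f m) -> 0 <= rsum f N.
Proof.
  move=> H; apply: Rle_trans (rsum_le (fun _ => 0) f N H).
  by rewrite rsum_const; lra.
Qed.

Lemma rsum_abs (f : nat -> R) (N : nat) :
  Rabs (rsum f N) <= rsum (fun m => Rabs (f m)) N.
Proof.
  elim: N => [|N IH] /=; first by rewrite Rabs_R0; lra.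
  by apply: Rle_trans (Rabs_triang _ _) _; lra.
Qed.

Lemma rsum_add (f : nat -> R) (N L : nat) :
  rsum f (N + L) = rsum f N + rsum (fun m => f (N + m)%nat) L.
Proof.
  elim: L => [|L IH]; first by rewrite Nat.add_0_r /=; ring.
  by rewrite Nat.add_succ_r /= IH Nat.add_succ_r; ring.
Qed.

Lemma rsum_le_range (f : nat -> R) (N M : nat) :
  (forall m, (1 <= m)%nat -> 0 <= f m) -> (N <= M)%nat -> rsum f N <= rsum f M.
Proof.
  move=> H HNM; have -> : M = (N + (M - N))%nat by lia.
  rewrite rsum_add.
  have := rsum_ge0 (fun m => f (N + m)%nat) (M - N) (fun m Hm => H (N + m)%nat ltac:(lia)).
  lra.
Qed.

Lemma rsum_progression_le (f : nat -> R) (K L : nat) :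
  (1 <= K)%nat -> (forall m, (1 <= m)%nat -> 0 <= f m) ->
  rsum (fun l => f (1 + K * l)%nat) L <= rsum f (1 + K * L).
Proof.
  move=> HK Hf; elim: L => [|L IH].
    by rewrite Nat.mul_0_r /=; have := Hf 1%nat ltac:(lia); lra.
  have E : (1 + K * S L = S (1 + K * L + (K - 1)))%nat by lia.
  have H := rsum_le_range f (1 + K * L) (1 + K * L + (K - 1)) Hf ltac:(lia).
  change (rsum (fun l => f (1 + K * l)%nat) L + f (1 + K * S L)%nat <= rsum f (1 + K * S L)).
  rewrite E -/(rsum f (S _)).
  change (rsum (fun l => f (1 + K * l)%nat) L + f (S (1 + K * L + (K - 1))) <=
    rsum f (1 + K * L + (K - 1)) + f (S (1 + K * L + (K - 1)))).
  lra.
Qed.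

(** * Exponential sums over k-th powers *)

Lemma one_minus_cos (t : R) : 1 - cos t = 2 * (sin (t / 2)) ^ 2.
Proof.
  have {1}-> : t = 2 * (t / 2) by field.
  by rewrite cos_2a_sin; ring.
Qed.

Lemma one_minus_cos_ge0 (t : R) : 0 <= 1 - cos t.
Proof. by have := COS_bound t; lra. Qed.

(** As [1 - cos t] is half of [|1 - exp (i t)|^2], this is the triangle inequality followed by
    [(u + v)^2 <= 2 (u^2 + v^2)]. *)
Lemma one_minus_cos_sub (s t : R) :
  1 - cos (s - t) <= 2 * ((1 - cos s) + (1 - cos t)).
Proof.
  rewrite !one_minus_cos.
  have -> : (s - t) / 2 = s / 2 - t / 2 by field.
  rewrite sin_minus.
  move: (sin2_cos2 (s / 2)) (sin2_cos2 (t / 2)); rewrite /Rsqr.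
  move: (sin (s / 2)) (cos (s / 2)) (sin (t / 2)) (cos (t / 2)) => a b c d Hab Hcd.
  have H1 : (a * d - b * c) ^ 2 + (a * d + b * c) ^ 2 = 2 * (a^2 * d^2 + b^2 * c^2) by ring.
  have H2 := pow2_ge_0 (a * d + b * c).
  have H3 : a^2 * d^2 <= a^2.
    have := pow2_ge_0 a; have := pow2_ge_0 (a * c); nra.
  have H4 : b^2 * c^2 <= c^2.
    have := pow2_ge_0 c; have := pow2_ge_0 (a * c); nra.
  lra.
Qed.

Lemma one_minus_cos_le (t : R) : 1 - cos t <= t ^ 2 / 2.
Proof.
  rewrite one_minus_cos.
  have H : Rabs (sin (t / 2)) <= Rabs (t / 2).
    have pos : forall u, 0 <= u -> Rabs (sin u) <= u.
      move=> u [Hu|<-]; last by rewrite sin_0 Rabs_R0; lra.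
      case: (Rle_lt_dec u PI) => Hp.
        rewrite Rabs_pos_eq; first by left; apply: sin_lt_x.
        by apply: sin_ge_0; lra.
      have := SIN_bound u; have := PI2_1; move=> P [S1 S2].
      by apply: Rabs_le; lra.
    case: (Rle_lt_dec 0 (t / 2)) => Ht.
      by rewrite (Rabs_pos_eq (t / 2)) //; apply: pos.
    rewrite -(Rabs_Ropp (sin _)) -sin_neg (Rabs_left (t / 2)) //.
    by apply: pos; lra.
  have H2 : sin (t / 2) ^ 2 <= (t / 2) ^ 2.
    rewrite -(pow2_abs (sin _)) -(pow2_abs (t / 2)).
    by apply: pow_incr; split=> //; apply: Rabs_pos.
  lra.
Qed.

Lemma one_minus_cos_ge (t : R) : Rabs t <= 2 -> t ^ 2 / 4 <= 1 - cos t.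
Proof.
  move=> /Rabs_le_between [H1 H2].
  (* At order 0 this is the Taylor bound of degree 4, valid for [|t| <= 2]; there the quartic term
     costs at most [t^2 / 6]. *)
  have [_] := pre_cos_bound t 0 H1 H2.
  rewrite /cos_approx /cos_term /= => H.
  have Ht : 0 <= t ^ 2 <= 4 by nra.
  have E : cos t <= 1 - t ^ 2 / 2 + t ^ 2 * t ^ 2 / 24 by move: H; simpl; lra.
  nra.
Qed.

Lemma cos_add_2PI_Z (t : R) (z : Z) : cos (t + 2 * PI * IZR z) = cos t.
Proof.
  case: (Z_le_gt_dec 0 z) => Hz.
    have <- : Z.of_nat (Z.to_nat z) = z by lia.
    rewrite -INR_IZR_INZ -(cos_period t (Z.to_nat z)); congr cos; ring.
  have E : z = (- Z.of_nat (Z.to_nat (- z)))%Z by lia.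
  rewrite E opp_IZR -INR_IZR_INZ.
  rewrite -(cos_period (t + 2 * PI * - INR (Z.to_nat (- z))) (Z.to_nat (- z))).
  congr cos; ring.
Qed.

Lemma cos_le_far (u d : R) : 0 <= d <= PI -> d <= u <= 2 * PI - d -> cos u <= cos d.
Proof.
  move=> Hd Hu; case: (Rle_lt_dec u PI) => H.
    by apply: cos_decr_1; lra.
  have -> : cos u = cos (2 * PI - u).
    have -> : 2 * PI - u = - (u + 2 * PI * IZR (-1)) by rewrite /=; ring.
    by rewrite cos_neg cos_add_2PI_Z.
  by apply: cos_decr_1; lra.
Qed.

Lemma exists_nearest_2PI (t : R) : exists a : Z, Rabs (t - 2 * PI * IZR a) <= PI.
Proof.
  have HP := PI_RGT_0.
  (* [up] is the floor plus one, so the shift by one half rounds to a nearest integer. *)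
  exists (up (t / (2 * PI) - 1 / 2)).
  have [H1 H2] := archimed (t / (2 * PI) - 1 / 2).
  move: (IZR (up _)) H1 H2 => a H1 H2.
  have -> : t - 2 * PI * a = 2 * PI * (t / (2 * PI) - a) by field; lra.
  rewrite Rabs_mult (Rabs_pos_eq (2 * PI)); last lra.
  have : Rabs (t / (2 * PI) - a) <= 1 / 2 by apply: Rabs_le; lra.
  nra.
Qed.

(** * Differencing, and lower bounds for cosine sums *)

Definition fdiff (h : nat) (f : nat -> R) (m : nat) : R := f (m + h)%nat - f m.

(** Each difference costs a factor 4: [one_minus_cos_sub] gives two sums with weight 2, both
    contained in the sum over the range lengthened by [h]. It is read backwards: if the iterated
    difference stays away from [2 pi Z], the original sum is large. *)
Lemma rsum_cos_fdiff (h j : nat) : forall (f : nat -> R) (P : nat),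
  rsum (fun m => 1 - cos (Nat.iter j (fdiff h) f m)) P
    <= 4 ^ j * rsum (fun m => 1 - cos (f m)) (P + j * h).
Proof.
  elim: j => [|j IH] f P; first by rewrite /= Nat.add_0_r; lra.
  set g := Nat.iter j (fdiff h) f.
  have H1 : rsum (fun m => 1 - cos (Nat.iter (S j) (fdiff h) f m)) P <=
    2 * (rsum (fun m => 1 - cos (g (h + m)%nat)) P + rsum (fun m => 1 - cos (g m)) P).
    rewrite -rsum_plus -rsum_scal; apply: rsum_le => m _.
    rewrite [Nat.iter _ _ _]/= -/g /fdiff (Nat.add_comm m h).
    exact: one_minus_cos_sub.
  have pos : forall m, (1 <= m)%nat -> 0 <= 1 - cos (g m).
    by move=> m _; apply: one_minus_cos_ge0.
  have H2 := rsum_add (fun m => 1 - cos (g m)) h P.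
  have H3 := rsum_ge0 (fun m => 1 - cos (g m)) h (fun m Hm => pos m (proj1 Hm)).
  have H4 := rsum_le_range (fun m => 1 - cos (g m)) P (h + P) pos ltac:(lia).
  have H5 := IH f (h + P)%nat.
  have E : (h + P + j * h = P + S j * h)%nat by lia.
  rewrite E -/g in H5.
  have -> : 4 ^ S j = 4 * 4 ^ j by [].
  lra.
Qed.

(** Leibniz rule for differences of a product with a linear factor; it drives the induction on the
    degree in [fdiff_iter_pow]. *)
Lemma fdiff_iter_mul (h j : nat) : forall (f : nat -> R) (m : nat),
  Nat.iter (S j) (fdiff h) (fun m => INR m * f m) m =
  INR (m + S j * h) * Nat.iter (S j) (fdiff h) f m
    + INR (S j * h) * Nat.iter j (fdiff h) f m.
Proof.
  elim: j => [|j IH] f m.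
    by rewrite /= /fdiff Nat.add_0_r !plus_INR; ring.
  rewrite [Nat.iter (S (S j)) _ _]/= -/(Nat.iter (S j) (fdiff h) _).
  have -> : fdiff h (fdiff h (Nat.iter j (fdiff h) (fun m => INR m * f m))) m =
    fdiff h (Nat.iter (S j) (fdiff h) (fun m => INR m * f m)) m by [].
  rewrite {1}/fdiff !IH.
  have -> : Nat.iter (S (S j)) (fdiff h) f m =
    Nat.iter (S j) (fdiff h) f (m + h)%nat - Nat.iter (S j) (fdiff h) f m by [].
  have E : Nat.iter (S j) (fdiff h) f m =
    Nat.iter j (fdiff h) f (m + h)%nat - Nat.iter j (fdiff h) f m by [].
  have -> : Nat.iter j (fdiff h) f (m + h)%nat =
    Nat.iter (S j) (fdiff h) f m + Nat.iter j (fdiff h) f m by rewrite E; ring.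
  have A (a b : nat) : INR (a + S b * h) = INR a + (INR b + 1) * INR h.
    by rewrite plus_INR mult_INR S_INR.
  have B (b : nat) : INR (S b * h) = (INR b + 1) * INR h by rewrite mult_INR S_INR.
  rewrite !A !B (plus_INR m h) (S_INR j); ring.
Qed.

Lemma fdiff_iter_ext (h j : nat) (f g : nat -> R) :
  (forall m, f m = g m) -> forall m, Nat.iter j (fdiff h) f m = Nat.iter j (fdiff h) g m.
Proof. by move=> E; elim: j => [//|j IH] m; rewrite /= /fdiff !IH. Qed.

Lemma fdiff_iter_pow (c : R) (h k m : nat) :
  Nat.iter k (fdiff h) (fun m => c * INR m ^ k) m = c * INR (fact k) * INR h ^ k.
Proof.
  elim: k m => [|k IH] m; first by rewrite /=; ring.
  rewrite (fdiff_iter_ext h (S k) _ (fun m => INR m * (c * INR m ^ k))); last first.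
    by move=> n; rewrite /=; ring.
  rewrite fdiff_iter_mul IH.
  have -> : Nat.iter (S k) (fdiff h) (fun m => c * INR m ^ k) m = 0.
    have -> : Nat.iter (S k) (fdiff h) (fun m => c * INR m ^ k) m =
      fdiff h (Nat.iter k (fdiff h) (fun m => c * INR m ^ k)) m by [].
    by rewrite /fdiff !IH; ring.
  by rewrite fact_simpl !mult_INR -tech_pow_Rmult; ring.
Qed.

Lemma pow_lt_compat (x y : R) (k : nat) : (1 <= k)%nat -> 0 <= x < y -> x ^ k < y ^ k.
Proof.
  move=> Hk Hxy; elim: k Hk => [|k IH] Hk; first lia.
  case: k IH Hk => [|k] IH _; first by rewrite /=; lra.
  have H := IH ltac:(lia); have H0 : 0 <= x ^ S k by apply: pow_le; lra.
  change (x * x ^ S k < y * y ^ S k); apply: Rmult_le_0_lt_compat; lra. 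
Qed.

Lemma exists_max_step (k : nat) (b c : R) (H : nat) :
  0 <= b <= c -> c < INR H ^ k * b ->
  exists h : nat, (1 <= h)%nat /\ INR h ^ k * b <= c < INR (S h) ^ k * b.
Proof.
  move=> Hb; elim: H => [|H IH] HH.
    exfalso; case: k HH => [|k] /= HH; nra.
  case: (Rle_lt_dec (INR H ^ k * b) c) => Hc; last exact: IH.
  case: H HH {IH} Hc => [|H] HH Hc; last by exists (S H); split; [lia|lra].
  by exfalso; move: HH; rewrite /= pow1; lra.
Qed.

(** Take the largest [h] with [h^k |b| <= pi]. Maximality and [h + 1 <= 2 h] put [h^k |b|] between
    [pi / 2^k] and [pi], so the constant k-th difference [k! h^k t], congruent to [h^k b], stays
    away from [2 pi Z]. The lower bound on [|b| M^k] says [2 k h <= M], so at least [M / 2] indices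
    survive the differencing, at a cost of [4^k]. *)
Lemma cos_sum_equidistributed (k : nat) : (1 <= k)%nat ->
  exists c : R, 0 < c /\ forall (M : nat) (t b : R) (a : Z),
    INR (fact k) * t = 2 * PI * IZR a + b -> Rabs b <= PI ->
    PI * (2 * INR k) ^ k <= Rabs b * INR M ^ k ->
    c * INR M <= rsum (fun m => 1 - cos (INR m ^ k * t)) M.
Proof.
  move=> Hk; have HP := PI_RGT_0.
  have H2k : 1 < 2 ^ k by apply: Rlt_pow_R1 => //; lra.
  set c1 := 1 - cos (PI / 2 ^ k).
  have Hd : 0 < PI / 2 ^ k < PI.
    split; first by apply: Rdiv_lt_0_compat; lra.
    by apply/Rlt_div_l; nra.
  have Hc1 : 0 < c1.
    have : cos (PI / 2 ^ k) < cos 0 by apply: cos_decreasing_1; lra.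
    by rewrite cos_0 /c1; lra.
  have H4 : 0 < 4 ^ k by apply: pow_lt; lra.
  exists (c1 / (2 * 4 ^ k)); split; first by apply: Rdiv_lt_0_compat; lra.
  move=> M t b a Et Hb HM.
  have Hkk : 1 < (2 * INR k) ^ k.
    apply: Rlt_pow_R1 => //; have := le_INR 1 k Hk; rewrite /=; lra.
  have [|h [Hh [Hh1 Hh2]]] := exists_max_step k (Rabs b) PI M (conj (Rabs_pos b) Hb); first nra.
  have Hh1' : 1 <= INR h by have := le_INR 1 h Hh; rewrite /=; lra.
  have Hhk : 0 < INR h ^ k by apply: pow_lt; lra.
  have b0 : 0 < Rabs b.
    have := Rabs_pos b; case=> // E; rewrite -E in HM; nra.
  have hM : (2 * k * h <= M)%nat.
    apply: INR_le; apply: Rnot_lt_le => Hlt.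
    have : INR M ^ k < INR (2 * k * h) ^ k.
      by apply: pow_lt_compat => //; split=> //; apply: pos_INR.
    rewrite !mult_INR Rpow_mult_distr [INR 2]/= => HH.
    have : Rabs b * INR M ^ k < Rabs b * ((2 * INR k) ^ k * INR h ^ k).
      by apply: Rmult_lt_compat_l.
    nra.
  have Hs := rsum_cos_fdiff h k (fun m => t * INR m ^ k) (M - k * h).
  have E1 : (M - k * h + k * h = M)%nat by lia.
  rewrite E1 in Hs.
  have E2 : cos (t * INR (fact k) * INR h ^ k) = cos (INR h ^ k * Rabs b).
    have -> : t * INR (fact k) * INR h ^ k =
      INR h ^ k * b + 2 * PI * IZR (Z.of_nat (h ^ k) * a).
      by rewrite mult_IZR -INR_IZR_INZ pow_INR -[t * _ * _]Rmult_comm (Rmult_comm t) Et; ring.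
    rewrite cos_add_2PI_Z.
    have [P|P] := Rle_lt_dec 0 b; first by rewrite Rabs_pos_eq.
    by rewrite Rabs_left // -cos_neg; congr cos; ring.
  have Hs2 : INR (M - k * h) * c1 <=
      rsum (fun m => 1 - cos (Nat.iter k (fdiff h) (fun m => t * INR m ^ k) m)) (M - k * h).
    rewrite -rsum_const; apply: rsum_le => m _.
    rewrite fdiff_iter_pow E2 /c1.
    have : cos (INR h ^ k * Rabs b) <= cos (PI / 2 ^ k).
      apply: cos_decr_1; try lra; try nra.
      apply/Rle_div_l; first lra.
      have : INR (S h) ^ k <= (2 * INR h) ^ k.
        by apply: pow_incr; rewrite S_INR; lra.
      rewrite Rpow_mult_distr; nra.
    lra.
  have HMh : INR M / 2 <= INR (M - k * h).
    rewrite minus_INR; last lia.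
    have := le_INR _ _ hM; rewrite !mult_INR [INR 2]/=; lra.
  have -> : rsum (fun m => 1 - cos (INR m ^ k * t)) M =
    rsum (fun m => 1 - cos (t * INR m ^ k)) M.
    by apply: rsum_ext => m _; rewrite Rmult_comm.
  have -> : c1 / (2 * 4 ^ k) * INR M = (INR M / 2 * c1) / 4 ^ k by field; lra.
  apply/Rle_div_l; first lra.
  nra.
Qed.

Lemma pow_one_mod (K l k : nat) : exists q : nat, ((1 + K * l) ^ k = 1 + K * q)%nat.
Proof.
  elim: k => [|k [q IH]]; first by exists 0%nat; rewrite /=; lia.
  by exists (q + l * (1 + K * q))%nat; rewrite Nat.pow_succ_r' IH; ring.
Qed.

(** Replacing [2 k] by [4 k] gains [2^k >= 2], which turns [pi] into [pi / 2]. *)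
Lemma pow_scaled_le (k m M : nat) (b : R) : (1 <= k)%nat -> (4 * k * m <= M)%nat ->
  Rabs b * INR M ^ k <= PI * (2 * INR k) ^ k -> INR m ^ k * Rabs b <= PI / 2.
Proof.
  move=> Hk Hm Hb; have HP := PI_RGT_0.
  have Hk1 : 1 <= INR k by have := le_INR 1 k Hk; rewrite /=; lra.
  have H1 : (4 * INR k * INR m) ^ k <= INR M ^ k.
    apply: pow_incr; split; first by have := pos_INR m; nra.
    by have := le_INR _ _ Hm; rewrite !mult_INR [INR 4]/=; lra.
  have H2 : 0 < (2 * INR k) ^ k by apply: pow_lt; lra.
  have H3 : 2 * (2 * INR k) ^ k <= (4 * INR k) ^ k.
    have -> : 4 * INR k = 2 * (2 * INR k) by ring.
    rewrite (Rpow_mult_distr 2 (2 * INR k)); apply: Rmult_le_compat_r; first lra.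
    have := Rle_pow 2 1 k ltac:(lra) Hk; lra.
  rewrite Rpow_mult_distr in H1.
  have H4 := Rabs_pos b; have Hmk : 0 <= INR m ^ k by apply: pow_le; apply: pos_INR.
  have H5 : Rabs b * ((4 * INR k) ^ k * INR m ^ k) <= PI * (2 * INR k) ^ k.
    by apply: Rle_trans Hb; apply: Rmult_le_compat_l.
  have H6 : Rabs b * (2 * (2 * INR k) ^ k * INR m ^ k) <= Rabs b * ((4 * INR k) ^ k * INR m ^ k).
    apply: Rmult_le_compat_l => //.
    by apply: Rmult_le_compat_r.
  apply: (Rmult_le_reg_l (2 * (2 * INR k) ^ k)); first lra.
  nra.
Qed.

Lemma fact_mod_or (k : nat) (a : Z) :
  (exists a' : Z, a = (Z.of_nat (fact k) * a')%Z) \/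
  (exists q r : Z, (a = Z.of_nat (fact k) * q + r /\ 1 <= r <= Z.of_nat (fact k) - 1)%Z).
Proof.
  have HK := lt_O_fact k.
  have H1 := Z.div_mod a (Z.of_nat (fact k)) ltac:(lia).
  have H2 := Z.mod_pos_bound a (Z.of_nat (fact k)) ltac:(lia).
  case: (Z.eq_dec (a mod Z.of_nat (fact k)) 0) => E.
    by left; exists (a / Z.of_nat (fact k))%Z; lia.
  by right; exists (a / Z.of_nat (fact k))%Z, (a mod Z.of_nat (fact k))%Z; lia.
Qed.

(** For [m = 1 mod k!] also [m^k = 1 mod k!], so [m^k t] is congruent to [2 pi r / k!] up to an
    error of at most [pi / (2 k!)], hence at distance at least [pi / k!] from [2 pi Z]. Other
    residue classes could send [m^k r / k!] to an integer; this one is a fixed proportion of all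
    [m]. *)
Lemma cos_sum_near_rational (k : nat) : (1 <= k)%nat ->
  exists (c : R) (M0 : nat), 0 < c /\ forall (M : nat) (t b : R) (q r : Z),
    (M0 <= M)%nat ->
    INR (fact k) * t = 2 * PI * IZR (Z.of_nat (fact k) * q + r) + b ->
    (1 <= r <= Z.of_nat (fact k) - 1)%Z ->
    Rabs b * INR M ^ k <= PI * (2 * INR k) ^ k ->
    c * INR M <= rsum (fun m => 1 - cos (INR m ^ k * t)) M.
Proof.
  move=> Hk; have HP := PI_RGT_0.
  set K := fact k; have HK : (1 <= K)%nat by have := lt_O_fact k; rewrite -/K; lia.
  have HK1 : 1 <= INR K by have := le_INR 1 K HK; rewrite /=; lra.
  have Hk1 : 1 <= INR k by have := le_INR 1 k Hk; rewrite /=; lra.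
  set c1 := 1 - cos (PI / INR K).
  have Hd : 0 < PI / INR K <= PI.
    split; first by apply: Rdiv_lt_0_compat; lra.
    by apply/Rle_div_l; nra.
  have Hc1 : 0 < c1.
    have : cos (PI / INR K) < cos 0 by apply: cos_decreasing_1; lra.
    by rewrite cos_0 /c1; lra.
  exists (c1 / (16 * INR k * INR K)), (16 * k * K)%nat; split.
    by apply: Rdiv_lt_0_compat; nra.
  move=> M t b q r HM Et Hr Hb.
  (* Small enough that [4 k (1 + K l) <= M] for [l <= L], as [pow_scaled_le] requires, and still at
     least [M / (16 k K)]. *)
  set L := (M / (8 * k * K))%nat.
  have HL1 : (8 * k * K * L <= M)%nat by apply: Nat.Div0.mul_div_le.
  have HL2 : (M < 8 * k * K * S L)%nat by apply: Nat.mul_succ_div_gt; nia.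
  have HL3 : (1 + K * L <= M)%nat by nia.
  have HL4 : (M <= 16 * k * K * L)%nat by nia.
  have pos m : (1 <= m)%nat -> 0 <= 1 - cos (INR m ^ k * t).
    by move=> _; apply: one_minus_cos_ge0.
  apply: Rle_trans (rsum_le_range (fun m => 1 - cos (INR m ^ k * t)) _ _ pos HL3).
  apply: Rle_trans (rsum_progression_le (fun m => 1 - cos (INR m ^ k * t)) K L HK pos).
  have H1 : INR L * c1 <= rsum (fun l => 1 - cos (INR (1 + K * l) ^ k * t)) L.
    rewrite -rsum_const; apply: rsum_le => l Hl.
    set m := (1 + K * l)%nat.
    have Hm : (4 * k * m <= M)%nat by rewrite /m; nia.
    have Hmb := pow_scaled_le k m M b Hk Hm Hb.
    have [p Hp] := pow_one_mod K l k.
    set e := INR m ^ k * b / INR K.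
    have He : Rabs e <= PI / (2 * INR K).
      rewrite /e Rabs_div; last lra.
      rewrite Rabs_mult (Rabs_pos_eq (INR m ^ k)); last by apply: pow_le; apply: pos_INR.
      rewrite (Rabs_pos_eq (INR K)); last lra.
      have -> : PI / (2 * INR K) = PI / 2 / INR K by field; lra.
      by apply: Rmult_le_compat_r => //; left; apply: Rinv_0_lt_compat; lra.
    have -> : INR m ^ k * t =
      (2 * PI * IZR r / INR K + e) + 2 * PI * IZR (Z.of_nat (m ^ k) * q + Z.of_nat p * r).
      have Et' : t = (2 * PI * (INR K * IZR q + IZR r) + b) / INR K.
        by rewrite INR_IZR_INZ -mult_IZR -plus_IZR -Et -INR_IZR_INZ; field; lra.
      rewrite plus_IZR !mult_IZR -!INR_IZR_INZ Et' /e pow_INR.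
      have Hp' : INR m ^ k = 1 + INR K * INR p.
        by rewrite -pow_INR /m Hp plus_INR mult_INR.
      rewrite Hp'; field; lra.
    rewrite cos_add_2PI_Z /c1.
    have Hr1 : 1 <= IZR r by apply: IZR_le; lia.
    have Hr2 : IZR r <= INR K - 1.
      rewrite INR_IZR_INZ -minus_IZR; apply: IZR_le; lia.
    have /Rabs_le_between [He1 He2] := He.
    have E1 : PI / (2 * INR K) = (PI / INR K) / 2 by field; lra.
    have E2 : 2 * PI * IZR r / INR K = 2 * IZR r * (PI / INR K) by field; lra.
    have E3 : PI = INR K * (PI / INR K) by field; lra.
    suff : cos (2 * PI * IZR r / INR K + e) <= cos (PI / INR K) by lra.
    apply: cos_le_far; first lra.
    rewrite E1 in He1 He2; rewrite E2 {4}E3.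
    move: (PI / INR K) Hd He1 He2 => d Hd He1 He2; nra.
  apply: Rle_trans H1.
  have H2 : INR M <= 16 * INR k * INR K * INR L.
    by have := le_INR _ _ HL4; rewrite !mult_INR [INR 16]/=; lra.
  have -> : c1 / (16 * INR k * INR K) * INR M = INR M * c1 / (16 * INR k * INR K).
    by field; lra.
  apply/Rle_div_l; first nra.
  nra.
Qed.

(** Here [m^k t] does not wrap around for [m <= M / (4 k)], so [1 - cos] is quadratic. The indices
    between [L] and [2 L], with [L] about [M / (8 k)], suffice: there [m^k] is comparable to
    [M^k]. *)
Lemma cos_sum_near_zero (k : nat) : (1 <= k)%nat ->
  exists (c : R) (M0 : nat), 0 < c /\ forall (M : nat) (t : R),
    (M0 <= M)%nat ->
    Rabs t * INR M ^ k <= PI * (2 * INR k) ^ k ->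
    c * INR M * (t * INR M ^ k) ^ 2 <= rsum (fun m => 1 - cos (INR m ^ k * t)) M.
Proof.
  move=> Hk; have HP := PI_RGT_0.
  have Hk1 : 1 <= INR k by have := le_INR 1 k Hk; rewrite /=; lra.
  have H16 : 0 < (16 * INR k) ^ k by apply: pow_lt; lra.
  exists (/ (64 * INR k * ((16 * INR k) ^ k) ^ 2)), (16 * k)%nat; split.
    by apply: Rinv_0_lt_compat; apply: Rmult_lt_0_compat; [lra | apply: pow_lt].
  move=> M t HM Ht.
  set L := (M / (8 * k))%nat.
  have HL1 : (8 * k * L <= M)%nat by apply: Nat.Div0.mul_div_le.
  have HL2 : (M < 8 * k * S L)%nat by apply: Nat.mul_succ_div_gt; nia.
  have HL3 : (L + L <= M)%nat by nia.
  have HL4 : (M <= 16 * k * L)%nat by nia.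
  have HL5 : INR M <= 16 * INR k * INR L.
    by have := le_INR _ _ HL4; rewrite !mult_INR [INR 16]/=; lra.
  have pos m : (1 <= m)%nat -> 0 <= 1 - cos (INR m ^ k * t).
    by move=> _; apply: one_minus_cos_ge0.
  apply: Rle_trans (rsum_le_range (fun m => 1 - cos (INR m ^ k * t)) _ _ pos HL3).
  rewrite rsum_add.
  have H0 := rsum_ge0 (fun m => 1 - cos (INR m ^ k * t)) L (fun m Hm => pos m (proj1 Hm)).
  have H1 : INR L * ((INR L ^ k * t) ^ 2 / 4) <=
      rsum (fun m => 1 - cos (INR (L + m) ^ k * t)) L.
    rewrite -rsum_const; apply: rsum_le => m Hm.
    have Hm4 : (4 * k * (L + m) <= M)%nat by nia.
    have Hmb := pow_scaled_le k (L + m) M t Hk Hm4 Ht.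
    have HLm : INR L ^ k <= INR (L + m) ^ k.
      by apply: pow_incr; split; [apply: pos_INR | apply: le_INR; lia].
    have HLp : 0 <= INR L ^ k by apply: pow_le; apply: pos_INR.
    apply: Rle_trans (one_minus_cos_ge _ _).
      suff : (INR L ^ k) ^ 2 * t ^ 2 <= (INR (L + m) ^ k) ^ 2 * t ^ 2.
        by rewrite !Rpow_mult_distr; lra.
      apply: Rmult_le_compat_r; first exact: pow2_ge_0.
      by apply: pow_incr.
    rewrite Rabs_mult (Rabs_pos_eq (_ ^ _)); last lra.
    by have := PI_4; lra.
  set u := INR L ^ k in H1.
  have Hu : INR M ^ k <= (16 * INR k) ^ k * u.
    by rewrite /u -Rpow_mult_distr; apply: pow_incr; split=> //; apply: pos_INR.
  have Hv : 0 <= INR M ^ k by apply: pow_le; apply: pos_INR.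
  have Hu2 : (INR M ^ k) ^ 2 <= ((16 * INR k) ^ k) ^ 2 * u ^ 2.
    by rewrite -Rpow_mult_distr; apply: pow_incr.
  move: (INR M ^ k) Hv Hu Hu2 => v Hv Hu Hu2.
  have HD : 0 < ((16 * INR k) ^ k) ^ 2 by apply: pow_lt.
  move: (((16 * INR k) ^ k) ^ 2) HD Hu2 => D HD Hu2.
  have -> : / (64 * INR k * D) * INR M * (t * v) ^ 2 =
    (INR M / (16 * INR k)) * (v ^ 2 * t ^ 2 / D) / 4 by field; lra.
  have HA : INR M / (16 * INR k) <= INR L by apply/Rle_div_l; lra.
  have HB : v ^ 2 * t ^ 2 / D <= u ^ 2 * t ^ 2.
    apply/Rle_div_l => //.
    have := pow2_ge_0 t; nra.
  have HA0 : 0 <= INR M / (16 * INR k).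
    by apply: Rdiv_le_0_compat; [apply: pos_INR | lra].
  have HB0 : 0 <= v ^ 2 * t ^ 2 / D.
    apply: Rdiv_le_0_compat => //; apply: Rmult_le_pos; exact: pow2_ge_0.
  have := Rmult_le_compat _ _ _ _ HA0 HB0 HA HB.
  rewrite (Rpow_mult_distr u) in H1; lra.
Qed.

(* Write [k! t = 2 pi a + b] with [|b| <= pi].  If [b] is not tiny, a k-th difference
   of suitable step turns [m^k t] into [k! h^k t], far from 0 mod 2 pi.  If [b] is tiny,
   [t] is close to [2 pi a / k!]: either [k!] does not divide [a], and the [m = 1 mod k!]
   stay close to the nonzero fraction, or [t] itself is tiny. *)
Lemma cos_sum_lower_bound (k : nat) : (1 <= k)%nat ->
  exists (c : R) (M0 : nat), 0 < c /\ forall (M : nat) (t : R),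
    (M0 <= M)%nat -> Rabs t <= PI ->
    c * INR M * Rmin 1 ((t * INR M ^ k) ^ 2)
      <= rsum (fun m => 1 - cos (INR m ^ k * t)) M.
Proof.
  move=> Hk; have HP := PI_RGT_0.
  have [c1 [Hc1 H1]] := cos_sum_equidistributed k Hk.
  have [c2 [M2 [Hc2 H2]]] := cos_sum_near_rational k Hk.
  have [c3 [M3 [Hc3 H3]]] := cos_sum_near_zero k Hk.
  have HK : 1 <= INR (fact k) by have := le_INR 1 _ (lt_O_fact k); rewrite [INR 1]/=.
  have Hk1 : 1 <= INR k by have := le_INR 1 k Hk; rewrite /=; lra.
  set c := Rmin c1 (Rmin c2 c3).
  have Hcc1 : c <= c1 by apply: Rmin_l.
  have Hcc2 : c <= c2 by apply: Rle_trans (Rmin_r _ _) (Rmin_l _ _).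
  have Hcc3 : c <= c3 by apply: Rle_trans (Rmin_r _ _) (Rmin_r _ _).
  have Hc : 0 < c by rewrite /c; do 2?[apply: Rmin_glb_lt => //].
  exists c, (M2 + M3 + 2 * k + 1)%nat; split=> // M t HM Ht.
  have HM0 := pos_INR M.
  have G1 c' : c <= c' -> c' * INR M <= rsum (fun m => 1 - cos (INR m ^ k * t)) M ->
    c * INR M * Rmin 1 ((t * INR M ^ k) ^ 2)
      <= rsum (fun m => 1 - cos (INR m ^ k * t)) M.
    move=> Hc'; apply: Rle_trans.
    have := Rmin_l 1 ((t * INR M ^ k) ^ 2).
    have : c * INR M <= c' * INR M by apply: Rmult_le_compat_r.
    have : 0 <= c * INR M by apply: Rmult_le_pos; lra.
    nra.
  have [a Ha] := exists_nearest_2PI (INR (fact k) * t).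
  set b := INR (fact k) * t - 2 * PI * IZR a in Ha.
  have Eb : INR (fact k) * t = 2 * PI * IZR a + b by rewrite /b; ring.
  case: (Rle_lt_dec (PI * (2 * INR k) ^ k) (Rabs b * INR M ^ k)) => Hb.
    exact: (G1 c1 Hcc1 (H1 M t b a Eb Ha Hb)).
  case: (fact_mod_or k a) => [[a' Ea]|[q [r [Ea Hr]]]]; last first.
    by rewrite Ea in Eb; apply: (G1 c2 Hcc2 (H2 M t b q r ltac:(lia) Eb Hr ltac:(lra))).
  have HMk : 0 < INR M ^ k by apply: pow_lt; apply: lt_0_INR; lia.
  (* The strict inequality, which comes from [M > 2 k], is what forces [a' = 0] below: [|t| <= pi]
     alone would allow [a'] to be 1 or -1. *)
  have HbP : Rabs b < PI.
    have : (2 * INR k) ^ k < INR M ^ k.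
      apply: pow_lt_compat => //; split; first lra.
      have := lt_INR (2 * k) M ltac:(lia); rewrite mult_INR [INR 2]/=; lra.
    have := Rabs_pos b; nra.
  have Et : t = 2 * PI * IZR a' + b / INR (fact k).
    have : INR (fact k) * t = INR (fact k) * (2 * PI * IZR a' + b / INR (fact k)).
      rewrite Eb Ea mult_IZR -INR_IZR_INZ; field; lra.
    by move=> E; apply: (Rmult_eq_reg_l (INR (fact k))) => //; lra.
  have Hbk : Rabs (b / INR (fact k)) <= Rabs b.
    rewrite Rabs_div; last lra.
    rewrite (Rabs_pos_eq (INR _)); last lra.
    apply/Rle_div_l; first lra; have := Rabs_pos b; nra.
  have a0 : a' = 0%Z.
    have : Rabs (2 * PI * IZR a') < 2 * PI.
      have -> : 2 * PI * IZR a' = t - b / INR (fact k) by lra.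
      by apply: Rle_lt_trans (Rabs_triang _ _) _; rewrite Rabs_Ropp; lra.
    rewrite Rabs_mult (Rabs_pos_eq (2 * PI)); last lra.
    move=> H; have : Rabs (IZR a') < 1 by nra.
    rewrite -abs_IZR => /lt_IZR; lia.
  rewrite a0 in Et.
  have Ht2 : Rabs t <= Rabs b by rewrite {1}Et Rmult_0_r Rplus_0_l.
  have := H3 M t ltac:(lia) ltac:(nra).
  apply: Rle_trans.
  have HX := pow2_ge_0 (t * INR M ^ k).
  have := Rmin_r 1 ((t * INR M ^ k) ^ 2).
  have : c * INR M <= c3 * INR M by apply: Rmult_le_compat_r.
  have : 0 <= c * INR M by apply: Rmult_le_pos; lra.
  move: HX; move: ((t * INR M ^ k) ^ 2) => y HX.
  move: (Rmin 1 y) => x Ha1 Ha2 Ha3; nra.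
Qed.

(** * Fourier inversion *)

(* Polar form: [modulus r t * exp (i * phase r t) = (1 - r) / (1 - r exp (i t))]. *)
Definition modulus (r t : R) : R := (1 - r) / sqrt (1 - 2 * r * cos t + r ^ 2).
Definition phase (r t : R) : R := atan (r * sin t / (1 - r * cos t)).

Lemma one_minus_rcos_gt0 (r t : R) : 0 <= r < 1 -> 0 < 1 - r * cos t.
Proof. by move=> Hr; have := COS_bound t; nra. Qed.

Lemma sqr_dist_eq (r t : R) :
  1 - 2 * r * cos t + r ^ 2 = (1 - r * cos t) ^ 2 + (r * sin t) ^ 2.
Proof. have := sin2_cos2 t; rewrite /Rsqr; nra. Qed.

Lemma sqr_dist_eq_cos (r t : R) :
  1 - 2 * r * cos t + r ^ 2 = (1 - r) ^ 2 + 2 * r * (1 - cos t).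
Proof. ring. Qed.

Lemma sqr_dist_gt0 (r t : R) : 0 <= r < 1 -> 0 < 1 - 2 * r * cos t + r ^ 2.
Proof. by move=> Hr; rewrite sqr_dist_eq_cos; have := one_minus_cos_ge0 t; nra. Qed.

Lemma sqrt_sqr_dist (r t : R) : 0 <= r < 1 ->
  sqrt (1 + (r * sin t / (1 - r * cos t))²) =
  sqrt (1 - 2 * r * cos t + r ^ 2) / (1 - r * cos t).
Proof.
  move=> Hr; have HA := one_minus_rcos_gt0 r t Hr.
  have -> : 1 + (r * sin t / (1 - r * cos t))² =
    (1 - 2 * r * cos t + r ^ 2) / (1 - r * cos t) ^ 2.
    by rewrite sqr_dist_eq /Rsqr; field; lra.
  rewrite sqrt_div_alt; last by apply: pow_lt.
  by rewrite sqrt_pow2 //; lra.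
Qed.

(** Real part of [(1 - r exp (i t)) * (modulus r t * exp (i * phase r t)) * exp (i y) = (1 - r) *
    exp (i y)]; with it the Fourier argument stays within real functions. *)
Lemma modulus_phase_eq (r t y : R) : 0 <= r < 1 ->
  modulus r t * cos (y + phase r t) - r * (modulus r t * cos (y + phase r t + t))
    = (1 - r) * cos y.
Proof.
  move=> Hr; have HA := one_minus_rcos_gt0 r t Hr; have HD := sqr_dist_gt0 r t Hr.
  have HE := sqr_dist_eq r t.
  have HS := sqrt_lt_R0 _ HD; have HQ := sqrt_sqrt _ (Rlt_le _ _ HD).
  rewrite !cos_plus !sin_plus /phase cos_atan sin_atan sqrt_sqr_dist // /modulus.
  move: (sqrt _) HS HQ => D HS HQ; rewrite HE in HQ.
  have HD2 : D ^ 2 = (1 - r * cos t) ^ 2 + (r * sin t) ^ 2 by rewrite -HQ; ring.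
  move: (cos t) (sin t) (cos y) (sin y) HA HQ HD2 => c s a b HA HQ HD2.
  apply: (Rmult_eq_reg_l (D ^ 2)); last by apply: pow_nonzero; lra.
  transitivity ((1 - r) * a * ((1 - r * c) ^ 2 + (r * s) ^ 2)); last by rewrite -HD2; ring.
  field; lra.
Qed.

Lemma modulus_ge0 (r t : R) : 0 <= r < 1 -> 0 <= modulus r t.
Proof.
  move=> Hr; apply: Rdiv_le_0_compat; first lra.
  by apply: sqrt_lt_R0; apply: sqr_dist_gt0.
Qed.

Lemma modulus_le1 (r t : R) : 0 <= r < 1 -> modulus r t <= 1.
Proof.
  move=> Hr; have HD := sqr_dist_gt0 r t Hr.
  apply/Rle_div_l; first exact: sqrt_lt_R0.
  rewrite Rmult_1_l -[1 - r](sqrt_pow2); last lra.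
  apply: sqrt_le_1_alt; rewrite sqr_dist_eq_cos; have := one_minus_cos_ge0 t; nra.
Qed.

Lemma modulus_continuous (r t : R) : 0 <= r < 1 -> continuous (modulus r) t.
Proof.
  move=> Hr; have HD := sqr_dist_gt0 r t Hr.
  apply: (ex_derive_continuous (modulus r)); rewrite /modulus; auto_derive.
  have E : 1 + - (2 * r * cos t) + r * (r * 1) = 1 - 2 * r * cos t + r ^ 2 by ring.
  rewrite E; split=> //; split=> //; have := sqrt_lt_R0 _ HD; lra.
Qed.

Lemma phase_is_derive (r t : R) : 0 <= r < 1 ->
  is_derive (phase r) t ((r * cos t - r ^ 2) / (1 - 2 * r * cos t + r ^ 2)).
Proof.
  move=> Hr; have HA := one_minus_rcos_gt0 r t Hr; have HD := sqr_dist_gt0 r t Hr.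
  rewrite /phase; auto_derive; first lra.
  have Hcs := sin2_cos2 t; rewrite /Rsqr in Hcs.
  rewrite sqr_dist_eq in HD *.
  have E : r * cos t - r ^ 2 = r * cos t - r ^ 2 * (sin t * sin t + cos t * cos t).
    by rewrite Hcs; ring.
  rewrite E; field; repeat split; try lra; nra.
Qed.

Lemma phase_continuous (r t : R) : 0 <= r < 1 -> continuous (phase r) t.
Proof.
  move=> Hr; apply: (ex_derive_continuous (phase r)).
  by eexists; apply: phase_is_derive.
Qed.

Fixpoint rprod (f : nat -> R) (N : nat) : R :=
  match N with O => 1 | S N' => rprod f N' * f N end.

Definition boltz (e : nat -> nat) (x : R) (m : nat) : R := exp (- (INR (e m) * x)).

(** Together with [argument], the polar form of the characteristic function of the size of a random
    partition: the part [e m] has a geometric multiplicity of ratio [boltz e x m], independently for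
    each [m]. *)
Definition amplitude (e : nat -> nat) (x : R) (N : nat) (t : R) : R :=
  rprod (fun m => modulus (boltz e x m) (INR (e m) * t)) N.

(** The phases are added without reduction modulo [2 pi]: the sum is continuous and can be compared
    with a linear function of [t]. *)
Definition argument (e : nat -> nat) (x : R) (N : nat) (t : R) : R :=
  rsum (fun m => phase (boltz e x m) (INR (e m) * t)) N.

Lemma boltz_bounds (e : nat -> nat) (x : R) (m : nat) :
  (1 <= e m)%nat -> 0 < x -> 0 < boltz e x m < 1.
Proof.
  move=> He Hx; split; first exact: exp_pos.
  rewrite /boltz -exp_0; apply: exp_increasing.
  have := le_INR 1 _ He; rewrite [INR 1]/=; nra.
Qed.

Section Fourier.

Variables (e : nat -> nat) (x : R).
Hypotheses (e_ge1 : forall m, (1 <= m)%nat -> (1 <= e m)%nat) (x_gt0 : 0 < x).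

Lemma boltz_range (m : nat) : 0 <= boltz e x (S m) < 1.
Proof. have := boltz_bounds e x (S m) (e_ge1 (S m) ltac:(lia)) x_gt0; lra. Qed.

Lemma amplitude_bounds (N : nat) (t : R) : 0 <= amplitude e x N t <= 1.
Proof.
  elim: N => [|N IH]; first by rewrite /amplitude /=; lra.
  have H1 := modulus_ge0 _ (INR (e (S N)) * t) (boltz_range N).
  have H2 := modulus_le1 _ (INR (e (S N)) * t) (boltz_range N).
  rewrite /amplitude /= -/(amplitude e x N t); nra.
Qed.

Lemma continuous_dilate (f : R -> R) (c t : R) :
  (forall u, continuous f u) -> continuous (fun t => f (c * t)) t.
Proof.
  move=> H; apply: (continuous_comp (fun t => c * t) f) => //.
  by apply: (continuous_mult (fun _ => c) (fun t => t)); [apply: continuous_const | apply: continuous_id].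
Qed.

Lemma amplitude_continuous (N : nat) (t : R) : continuous (amplitude e x N) t.
Proof.
  elim: N => [|N IH]; first exact: continuous_const.
  apply: (continuous_mult (amplitude e x N)) => //.
  apply: (continuous_dilate (modulus (boltz e x (S N)))) => u.
  by apply: modulus_continuous; apply: boltz_range.
Qed.

Lemma argument_continuous (N : nat) (t : R) : continuous (argument e x N) t.
Proof.
  elim: N => [|N IH]; first exact: continuous_const.
  apply: (continuous_plus (argument e x N)) => //.
  apply: (continuous_dilate (phase (boltz e x (S N)))) => u.
  by apply: phase_continuous; apply: boltz_range.
Qed.

Definition integrand (N : nat) (y t : R) : R :=
  amplitude e x N t * cos (argument e x N t - y * t).

Lemma integrand_continuous (N : nat) (y t : R) : continuous (integrand N y) t.
Proof.
  apply: (continuous_mult (amplitude e x N)); first exact: amplitude_continuous.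
  apply: (continuous_comp (fun t => argument e x N t - y * t) cos); last exact: continuous_cos.
  apply: (continuous_minus (argument e x N) (fun t => y * t)).
    exact: argument_continuous.
  exact: (continuous_dilate (fun u => u) y t (fun u => continuous_id u)).
Qed.

Lemma integrand_ex_RInt (N : nat) (y a b : R) : ex_RInt (integrand N y) a b.
Proof. by apply: ex_RInt_continuous => t _; apply: integrand_continuous. Qed.

(** Multiplication by [1 - r exp (i e t)] cancels the factor of the last part. After integration
    this is the recurrence [pS], up to the weights. *)
Lemma integrand_step (N : nat) (y t : R) :
  integrand (S N) y t - boltz e x (S N) * integrand (S N) (y - INR (e (S N))) t
    = (1 - boltz e x (S N)) * integrand N y t.
Proof.
  have H := modulus_phase_eq _ (INR (e (S N)) * t) (argument e x N t - y * t) (boltz_range N).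
  have E1 : amplitude e x (S N) t =
    amplitude e x N t * modulus (boltz e x (S N)) (INR (e (S N)) * t) by [].
  have E2 : argument e x (S N) t =
    argument e x N t + phase (boltz e x (S N)) (INR (e (S N)) * t) by [].
  rewrite /integrand E1 E2.
  move: (phase _ _) (modulus _ _) H => p m H.
  set q := INR (e (S N)) in H *.
  have -> : argument e x N t + p - (y - q) * t = argument e x N t - y * t + p + q * t by ring.
  have -> : argument e x N t + p - y * t = argument e x N t - y * t + p by ring.
  transitivity (amplitude e x N t * ((1 - boltz e x (S N)) * cos (argument e x N t - y * t))); last by ring.
  rewrite -H; ring.
Qed.

Lemma RInt_cos_int (z : Z) :
  RInt (fun t => cos (IZR z * t)) (- PI) PI = if (z =? 0)%Z then 2 * PI else 0.
Proof.
  case: Z.eqb_spec => [->|Hz].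
    rewrite (RInt_ext _ (fun _ => 1)); last by move=> t _; rewrite Rmult_0_l cos_0.
    by rewrite RInt_const /scal /= /mult /=; ring.
  have Hz' : IZR z <> 0 by apply: not_0_IZR.
  apply: is_RInt_unique.
  have -> : 0 = minus (sin (IZR z * PI) / IZR z) (sin (IZR z * - PI) / IZR z).
    have -> : sin (IZR z * PI) = 0 by apply: sin_eq_0_1; exists z.
    have -> : sin (IZR z * - PI) = 0 by apply: sin_eq_0_1; exists (- z)%Z; rewrite opp_IZR; ring.
    by rewrite /minus /plus /opp /=; field.
  apply: (is_RInt_derive (fun t => sin (IZR z * t) / IZR z) (fun t => cos (IZR z * t))).
    by move=> t _; auto_derive => //; field.
  by move=> t _; apply: (continuous_dilate cos) => u; apply: continuous_cos.
Qed.

(** [p N z] stands for the number of partitions of [z] into parts [e 1, ..., e N], known only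
    through its recurrence. Integer arguments, with value 0 below 0, keep that recurrence free of
    case distinctions. *)
Variable p : nat -> Z -> R.
Hypotheses (p0 : forall z, p 0%nat z = if (z =? 0)%Z then 1 else 0)
  (pS : forall N z, p (S N) z = p N z + p (S N) (z - Z.of_nat (e (S N)))%Z)
  (p_neg : forall N z, (z < 0)%Z -> p N z = 0).

(* The difference [d] of the two sides satisfies [d z = r d (z - e)] and is bounded for [z < 0],
   hence vanishes. *)
Lemma fourier_inversion (N : nat) : forall z : Z,
  RInt (integrand N (IZR z)) (- PI) PI =
    2 * PI * (p N z * exp (- (IZR z * x)) * rprod (fun m => 1 - boltz e x m) N).
Proof.
  have HP := PI_RGT_0.
  elim: N => [|N IH] z.
    rewrite (RInt_ext _ (fun t => cos (IZR z * t))); last first.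
      move=> t _; rewrite /integrand /amplitude /argument /= -cos_neg Rmult_1_l.
      by congr cos; ring.
    rewrite RInt_cos_int p0; case: Z.eqb_spec => [->|_] /=; last ring.
    by rewrite Rmult_0_l Ropp_0 exp_0; ring.
  have Hr := boltz_range N; set r := boltz e x (S N) in Hr.
  set Q := rprod (fun m => 1 - boltz e x m).
  pose d z := RInt (integrand (S N) (IZR z)) (- PI) PI -
    2 * PI * (p (S N) z * exp (- (IZR z * x)) * Q (S N)).
  suff : d z = 0 by rewrite /d; lra.
  have dstep z' : d z' = r * d (z' - Z.of_nat (e (S N)))%Z.
    have H1 : RInt (integrand (S N) (IZR z')) (- PI) PI -
        r * RInt (integrand (S N) (IZR (z' - Z.of_nat (e (S N))))) (- PI) PI =
        (1 - r) * RInt (integrand N (IZR z')) (- PI) PI.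
      have A1 := RInt_correct _ _ _ (integrand_ex_RInt (S N) (IZR z') (- PI) PI).
      have A2 := RInt_correct _ _ _
        (integrand_ex_RInt (S N) (IZR (z' - Z.of_nat (e (S N)))) (- PI) PI).
      have A3 := RInt_correct _ _ _ (integrand_ex_RInt N (IZR z') (- PI) PI).
      have B1 := is_RInt_unique _ _ _ _ (is_RInt_minus _ _ _ _ _ _ A1 (is_RInt_scal _ _ _ r _ A2)).
      have B2 := is_RInt_unique _ _ _ _ (is_RInt_scal _ _ _ (1 - r) _ A3).
      rewrite -[LHS]B1 -[RHS]B2.
      apply: RInt_ext => t _; rewrite minus_IZR -INR_IZR_INZ.
      exact: integrand_step.
    rewrite IH in H1; rewrite /d (pS N z').
    have -> : RInt (integrand (S N) (IZR z')) (- PI) PI =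
      r * RInt (integrand (S N) (IZR (z' - Z.of_nat (e (S N))))) (- PI) PI +
      (1 - r) * (2 * PI * (p N z' * exp (- (IZR z' * x)) * Q N)) by rewrite -/Q in H1; lra.
    have -> : Q (S N) = Q N * (1 - r) by [].
    have -> : exp (- (IZR z' * x)) = r * exp (- (IZR (z' - Z.of_nat (e (S N))) * x)).
      by rewrite /r /boltz -exp_plus minus_IZR -INR_IZR_INZ; congr exp; ring.
    ring.
  have dneg z' : (z' < 0)%Z -> Rabs (d z') <= 2 * PI.
    move=> Hz; rewrite /d p_neg //.
    have -> : forall u v w : R, u - 2 * PI * (0 * v * w) = u by move=> *; ring.
    have -> : 2 * PI = (PI - - PI) * 1 by ring.
    apply: abs_RInt_le_const; [lra | exact: integrand_ex_RInt |].
    move=> t _; rewrite /integrand Rabs_mult.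
    have [A1 A2] := amplitude_bounds (S N) t.
    rewrite (Rabs_pos_eq _ A1).
    have : Rabs (cos (argument e x (S N) t - IZR z' * t)) <= 1.
      by have := COS_bound (argument e x (S N) t - IZR z' * t); move=> B; apply: Rabs_le; lra.
    have := Rabs_pos (cos (argument e x (S N) t - IZR z' * t)); nra.
  have diter j z' : d z' = r ^ j * d (z' - Z.of_nat j * Z.of_nat (e (S N)))%Z.
    elim: j z' => [|j IHj] z'; first by rewrite /= Z.sub_0_r; ring.
    rewrite dstep IHj.
    have -> : (z' - Z.of_nat (e (S N)) - Z.of_nat j * Z.of_nat (e (S N)) =
      z' - Z.of_nat (S j) * Z.of_nat (e (S N)))%Z by lia.
    by rewrite /=; ring.
  apply: Rabs_eq_0; apply: Rle_antisym; last exact: Rabs_pos.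
  apply: Rnot_lt_le => Hd.
  have [n0 Hn0] := pow_lt_1_zero r ltac:(by rewrite Rabs_pos_eq; lra)
    (Rabs (d z) / (2 * PI)) ltac:(by apply: Rdiv_lt_0_compat; lra).
  (* Enough steps to make the argument negative, as each part is at least 1, and [r ^ j] smaller
     than [|d z| / (2 pi)]. *)
  pose j := (n0 + Z.to_nat (Z.abs z) + 1)%nat.
  have He := e_ge1 (S N) ltac:(lia).
  have Hz : (z - Z.of_nat j * Z.of_nat (e (S N)) < 0)%Z by rewrite /j; nia.
  have H1 := Hn0 j ltac:(rewrite /j; lia).
  have H2 := dneg _ Hz.
  have : Rabs (d z) < Rabs (d z).
    rewrite {1}(diter j z) Rabs_mult.
    apply: (Rle_lt_trans _ (Rabs (r ^ j) * (2 * PI))).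
      by apply: Rmult_le_compat_l => //; apply: Rabs_pos.
    by apply/Rlt_div_r; lra.
  lra.
Qed.

End Fourier.

(** * Estimates for the amplitude and the argument *)

(** Mean value theorem for [phase] minus its tangent at 0: the derivative of the difference carries
    the factor [1 - cos], which is quadratic, so the error is cubic. The weight [r / (1 - r)^3] is
    the one that [weight_le] handles with [j = 3]. *)
Lemma phase_linear_approx (r t : R) : 0 <= r < 1 ->
  Rabs (phase r t - r / (1 - r) * t) <= r * Rabs t ^ 3 / (1 - r) ^ 3.
Proof.
  move=> Hr.
  pose g u := phase r u - r / (1 - r) * u.
  pose dg u := (r * cos u - r ^ 2) / (1 - 2 * r * cos u + r ^ 2) - r / (1 - r).
  have Hd u : is_derive g u (dg u).
    apply: is_derive_minus; first exact: phase_is_derive.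
    by auto_derive => //; ring.
  have g0 : g 0 = 0.
    by rewrite /g /phase sin_0 Rmult_0_r /Rdiv Rmult_0_l atan_0; ring.
  have [c [Hc E]] := MVT_gen g 0 t dg (fun u _ => Hd u)
    (fun u _ => proj2 (continuity_pt_filterlim g u) (ex_derive_continuous g u (ex_intro _ _ (Hd u)))).
  rewrite g0 !Rminus_0_r in E; rewrite -/(g t) E Rabs_mult.
  have Hct : Rabs c <= Rabs t.
    move: Hc; rewrite /Rmin /Rmax; case: Rle_dec => H [H1 H2].
      by rewrite !Rabs_pos_eq; lra.
    by rewrite !Rabs_left1; lra.
  have HD := sqr_dist_gt0 r c Hr.
  have HC := one_minus_cos_ge0 c; have HC2 := one_minus_cos_le c.
  have -> : dg c = - (r * (1 + r) * (1 - cos c) / ((1 - r) * (1 - 2 * r * cos c + r ^ 2))).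
    by rewrite /dg; field; lra.
  have HD2 : (1 - r) ^ 2 <= 1 - 2 * r * cos c + r ^ 2 by rewrite sqr_dist_eq_cos; nra.
  have Hq : 0 < (1 - r) ^ 3 by apply: pow_lt; lra.
  have Hct2 : c ^ 2 <= Rabs t ^ 2.
    by rewrite -(pow2_abs c); apply: pow_incr; split=> //; apply: Rabs_pos.
  rewrite Rabs_Ropp Rabs_pos_eq; last first.
    apply: Rdiv_le_0_compat; first by do 2?[apply: Rmult_le_pos]; lra.
    by apply: Rmult_lt_0_compat; lra.
  have -> : r * Rabs t ^ 3 / (1 - r) ^ 3 = r * Rabs t ^ 2 / (1 - r) ^ 3 * Rabs t by field; lra.
  apply: Rmult_le_compat_r; first exact: Rabs_pos.
  apply: (Rmult_le_compat _ _ _ _).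
  - by do 2?[apply: Rmult_le_pos]; lra.
  - by left; apply: Rinv_0_lt_compat; apply: Rmult_lt_0_compat; lra.
  - rewrite Rmult_assoc; apply: Rmult_le_compat_l; first lra.
    by nra.
  - apply: Rinv_le_contravar => //.
    have -> : (1 - r) ^ 3 = (1 - r) * (1 - r) ^ 2 by ring.
    by apply: Rmult_le_compat_l; lra.
Qed.

Lemma modulus_sq (r t : R) : 0 <= r < 1 ->
  modulus r t ^ 2 * (1 - 2 * r * cos t + r ^ 2) = (1 - r) ^ 2.
Proof.
  move=> Hr; have HD := sqr_dist_gt0 r t Hr.
  have HS := sqrt_lt_R0 _ HD; have HQ := sqrt_sqrt _ (Rlt_le _ _ HD).
  rewrite /modulus; move: (sqrt _) HS HQ => D HS <-; field; lra.
Qed.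

Lemma sqr_le_reg (a b D : R) : 0 <= b -> 0 < D -> a ^ 2 * D <= b ^ 2 * D -> a <= b.
Proof.
  move=> Hb HD H; apply: Rnot_lt_le => Hab; have : b ^ 2 < a ^ 2 by nra.
  by move=> Hab2; have := Rmult_lt_compat_r D _ _ HD Hab2; lra.
Qed.

Lemma modulus_ge (r t : R) : 0 <= r < 1 ->
  exp (- (r * t ^ 2 / (1 - r) ^ 2)) <= modulus r t.
Proof.
  move=> Hr; have HD := sqr_dist_gt0 r t Hr.
  apply: (sqr_le_reg _ _ _ (modulus_ge0 r t Hr) HD); rewrite modulus_sq //.
  set v := r * t ^ 2 / (1 - r) ^ 2.
  have Hq : 0 < (1 - r) ^ 2 by apply: pow_lt; lra.
  have Hv : v * (1 - r) ^ 2 = r * t ^ 2 by rewrite /v; field; lra.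
  have Hv0 : 0 <= v.
    by apply: Rdiv_le_0_compat => //; apply: Rmult_le_pos; [lra | apply: pow2_ge_0].
  have HDle : 1 - 2 * r * cos t + r ^ 2 <= (1 - r) ^ 2 * (1 + v).
    have := Rmult_le_compat_l r _ _ (proj1 Hr) (one_minus_cos_le t).
    by rewrite sqr_dist_eq_cos; lra.
  have -> : exp (- v) ^ 2 = / exp (2 * v).
    by rewrite -exp_Ropp /= Rmult_1_r -exp_plus; congr exp; ring.
  have He := exp_ineq1_le (2 * v); have Hep := exp_pos (2 * v).
  rewrite Rmult_comm; apply/Rle_div_l => //; nra.
Qed.

Lemma modulus_le (r t : R) : / 4 <= r < 1 -> modulus r t <= exp (- ((1 - cos t) / 8)).
Proof.
  move=> Hr; have Hr' : 0 <= r < 1 by lra.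
  have HD := sqr_dist_gt0 r t Hr'.
  apply: (sqr_le_reg _ _ _ (Rlt_le _ _ (exp_pos _)) HD); rewrite modulus_sq //.
  have -> : exp (- ((1 - cos t) / 8)) ^ 2 = exp (- ((1 - cos t) / 4)).
    by rewrite /= Rmult_1_r -exp_plus; congr exp; field.
  have He := exp_ineq1_le (- ((1 - cos t) / 4)).
  have := COS_bound t; rewrite sqr_dist_eq_cos in HD *; move=> HC.
  apply: (Rle_trans _ ((1 - (1 - cos t) / 4) * ((1 - r) ^ 2 + 2 * r * (1 - cos t)))); last first.
    by apply: Rmult_le_compat_r; lra.
  move: (cos t) HC => c HC.
  (* Since [1 - c <= 2], the second factor is at least [r - (1 - r)^2 / 4], which is positive for
     [r >= 1/4]. *)
  have H : 0 <= (1 - c) * (2 * r - (1 - r) ^ 2 / 4 - r * (1 - c) / 2).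
    by apply: Rmult_le_pos; nra.
  lra.
Qed.

Section PowerWeights.

(* [X] stands for [x^(-1/k)]: the terms [m <= X] dominate all sums below. *)
Variables (k : nat) (X : R).
Hypotheses (k_ge1 : (1 <= k)%nat) (X_ge1 : 1 <= X).

Local Notation x := (/ X ^ k).
Local Notation e := (fun m : nat => (m ^ k)%nat).
Local Notation r := (boltz e x).

Lemma Xk_gt0 : 0 < X ^ k. Proof. by apply: pow_lt; lra. Qed.

Lemma inv_Xk_gt0 : 0 < x. Proof. by apply: Rinv_0_lt_compat; apply: Xk_gt0. Qed.

Lemma pow_ge1 (m : nat) : (1 <= m)%nat -> (1 <= m ^ k)%nat.
Proof. by move=> Hm; have := Nat.pow_le_mono_l 1 m k Hm; rewrite Nat.pow_1_l. Qed.

Lemma exponent_gt0 (m : nat) : (1 <= m)%nat -> 0 < INR m ^ k * x.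
Proof.
  move=> Hm; apply: Rmult_lt_0_compat; last exact: inv_Xk_gt0.
  by apply: pow_lt; apply: lt_0_INR; lia.
Qed.

Lemma boltz_pow_range (m : nat) : (1 <= m)%nat -> 0 <= r m < 1.
Proof. by move=> Hm; have := boltz_bounds e x m (pow_ge1 m Hm) inv_Xk_gt0; lra. Qed.

Lemma boltz_powE (m : nat) : r m = exp (- (INR m ^ k * x)).
Proof. by rewrite /boltz pow_INR. Qed.

Lemma one_minus_boltz_ge (m : nat) : (1 <= m)%nat ->
  INR m ^ k * x <= (1 + INR m ^ k * x) * (1 - r m).
Proof.
  move=> Hm; have Hy := exponent_gt0 m Hm; rewrite boltz_powE exp_Ropp.
  have He := exp_ineq1_le (INR m ^ k * x).
  move: (INR m ^ k * x) Hy He => y Hy He.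
  have Hp := exp_pos y.
  have : (1 + y) * / exp y <= 1 by apply/Rle_div_l => //; lra.
  lra.
Qed.

(** [3125 = 5^5]. Of the five powers, three absorb up to three factors [1 / (1 - r)] and two make
    the sum over [m] converge. *)
Lemma exp_ge_pow5 (y : R) : 0 <= y -> (1 + y) ^ 5 <= 3125 * exp y.
Proof.
  move=> Hy.
  have -> : exp y = exp (y / 5) ^ 5.
    by rewrite /= Rmult_1_r -!exp_plus; congr exp; field.
  have H := exp_ineq1_le (y / 5).
  have : ((1 + y) / 5) ^ 5 <= exp (y / 5) ^ 5 by apply: pow_incr; lra.
  have -> : ((1 + y) / 5) ^ 5 = (1 + y) ^ 5 / 3125 by field.
  lra.
Qed.

(** One majorant serves three sums: [j = 1] for the mean, [j = 2] for the amplitude, [j = 3] for the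
    argument. It rests on [y / (1 - exp (- y)) <= 1 + y]. *)
Lemma weight_le (j m : nat) : (1 <= m)%nat -> (j <= 3)%nat ->
  r m * ((INR m ^ k * x) / (1 - r m)) ^ j <= 3125 / (1 + INR m ^ k * x) ^ 2.
Proof.
  move=> Hm Hj; have Hy := exponent_gt0 m Hm; have Hr := boltz_pow_range m Hm.
  have H1 : (INR m ^ k * x) / (1 - r m) <= 1 + INR m ^ k * x.
    by apply/Rle_div_l; [lra | apply: one_minus_boltz_ge].
  have H0 : 0 <= (INR m ^ k * x) / (1 - r m) by apply: Rdiv_le_0_compat; lra.
  rewrite {1}boltz_powE.
  move: (INR m ^ k * x / (1 - r m)) H0 H1 => q H0 H1.
  move: (INR m ^ k * x) H1 Hy => y H1 Hy.
  have H2 : q ^ j <= (1 + y) ^ 3.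
    apply: (Rle_trans _ ((1 + y) ^ j)); first by apply: pow_incr; lra.
    by apply: Rle_pow; [lra | lia].
  have H3 := exp_ge_pow5 y ltac:(lra).
  have Hp := exp_pos y.
  have Hp2 : 0 < (1 + y) ^ 2 by apply: pow_lt; lra.
  apply: (proj1 (Rle_div_r _ _ _ Hp2)).
  rewrite exp_Ropp.
  apply: (Rle_trans _ (/ exp y * (1 + y) ^ 3 * (1 + y) ^ 2)).
    apply: Rmult_le_compat_r; first by apply: pow_le; lra.
    by apply: Rmult_le_compat_l => //; left; apply: Rinv_0_lt_compat.
  have -> : / exp y * (1 + y) ^ 3 * (1 + y) ^ 2 = (1 + y) ^ 5 / exp y by field; lra.
  by apply/Rle_div_l.
Qed.

(* Telescoping: [1 / (X + m)^2 <= 1 / (X + m - 1) - 1 / (X + m)]. *)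
Lemma sum_inv_sq_le (N : nat) :
  rsum (fun m => X ^ 2 / (X + INR m) ^ 2) N <= X - X ^ 2 / (X + INR N).
Proof.
  elim: N => [|N IH].
    by rewrite /= Rplus_0_r; right; field; lra.
  apply: (Rle_trans _ (X - X ^ 2 / (X + INR N) + X ^ 2 / (X + INR (S N)) ^ 2)).
    have -> : forall f, rsum f (S N) = rsum f N + f (S N) by []; lra.
  have HN := pos_INR N; rewrite S_INR.
  have -> : X ^ 2 / (X + INR N) = X ^ 2 * / (X + INR N) by [].
  have H : X ^ 2 / (X + (INR N + 1)) ^ 2 <= X ^ 2 * (/ (X + INR N) - / (X + (INR N + 1))).
    apply: Rmult_le_compat_l; first exact: pow2_ge_0.
    have -> : / (X + INR N) - / (X + (INR N + 1)) = / ((X + INR N) * (X + (INR N + 1))).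
      by field; lra.
    apply: Rinv_le_contravar; nra.
  rewrite /Rdiv in H *; lra.
Qed.

(** [1 + (m / X)^k >= (1 + m / X) / 2], whether [m <= X] or not, reduces every [k] to the
    telescoping sum; squaring the 2 gives [12500 = 4 * 3125]. *)
Lemma sum_weight_le (N : nat) :
  rsum (fun m => 3125 / (1 + INR m ^ k * x) ^ 2) N <= 12500 * X.
Proof.
  apply: (Rle_trans _ (12500 * rsum (fun m => X ^ 2 / (X + INR m) ^ 2) N)); last first.
    have := sum_inv_sq_le N; have : 0 <= X ^ 2 / (X + INR N).
      by apply: Rdiv_le_0_compat; [apply: pow2_ge_0 | have := pos_INR N; lra].
    lra.
  rewrite -rsum_scal; apply: rsum_le => m [Hm _].
  have Hy := exponent_gt0 m Hm; have HmR := pos_INR m.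
  have Hz : (X + INR m) / (2 * X) <= 1 + INR m ^ k * x.
    have -> : (X + INR m) / (2 * X) = (1 + INR m / X) / 2 by field; lra.
    have -> : INR m ^ k * x = (INR m / X) ^ k by rewrite /Rdiv Rpow_mult_distr pow_inv.
    have Hz0 : 0 <= INR m / X by apply: Rdiv_le_0_compat; lra.
    case: (Rle_lt_dec (INR m / X) 1) => H.
      by have := pow_le _ k Hz0; lra.
    by have := Rle_pow _ 1 k (Rlt_le _ _ H) k_ge1; rewrite pow_1; lra.
  have Hz0 : 0 < (X + INR m) / (2 * X) by apply: Rdiv_lt_0_compat; lra.
  have Hz2 : ((X + INR m) / (2 * X)) ^ 2 <= (1 + INR m ^ k * x) ^ 2 by apply: pow_incr; lra.
  have -> : 12500 * (X ^ 2 / (X + INR m) ^ 2) = 3125 * / (((X + INR m) / (2 * X)) ^ 2).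
    by field; lra.
  apply: Rmult_le_compat_l; first lra.
  by apply: Rinv_le_contravar => //; apply: pow_lt.
Qed.

(** The expected size of the random partition, and also the slope of [argument] at 0. The saddle
    point equation [mean = n] removes the linear term of the phase. *)
Definition mean (N : nat) : R := rsum (fun m => INR m ^ k * (r m / (1 - r m))) N.

Lemma mean_term_eq (m : nat) : (1 <= m)%nat ->
  INR m ^ k * (r m / (1 - r m)) = X ^ k * (r m * (INR m ^ k * x / (1 - r m)) ^ 1).
Proof. by move=> Hm; have := boltz_pow_range m Hm; have := Xk_gt0; move=> *; field; lra. Qed.

Lemma mean_le (N : nat) : mean N <= 12500 * X * X ^ k.
Proof.
  have HX := Xk_gt0.
  apply: (Rle_trans _ (X ^ k * rsum (fun m => 3125 / (1 + INR m ^ k * x) ^ 2) N)).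
    rewrite -rsum_scal; apply: rsum_le => m [Hm _]; rewrite mean_term_eq //.
    by apply: Rmult_le_compat_l; [lra | apply: weight_le => //; lia].
  have := sum_weight_le N; nra.
Qed.

Lemma boltz_ge_quarter (m : nat) : (1 <= m)%nat -> INR m <= X -> / 4 <= r m.
Proof.
  move=> Hm HmX; rewrite boltz_powE exp_Ropp; have HX := Xk_gt0.
  have Hy : INR m ^ k * x <= 1.
    apply/Rle_div_l => //; rewrite Rmult_1_l; apply: pow_incr; split=> //; exact: pos_INR.
  have : exp (INR m ^ k * x) <= 3.
    apply: Rle_trans exp_le_3; case: Hy => [Hy|->]; last by right.
    by left; apply: exp_increasing.
  move=> H; apply: Rinv_le_contravar; [exact: exp_pos | lra].
Qed.

Lemma mean_term_ge (m : nat) : (1 <= m)%nat -> INR m <= X ->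
  X ^ k / 4 <= INR m ^ k * (r m / (1 - r m)).
Proof.
  move=> Hm HmX; have Hr := boltz_pow_range m Hm; have Hq := boltz_ge_quarter m Hm HmX.
  have HX := Xk_gt0; have Hy := exponent_gt0 m Hm.
  have H1 : 1 - r m <= INR m ^ k * x.
    by rewrite boltz_powE; have := exp_ineq1_le (- (INR m ^ k * x)); lra.
  rewrite mean_term_eq // pow_1 /Rdiv; apply: Rmult_le_compat_l; first lra.
  have : 1 <= INR m ^ k * x / (1 - r m) by apply/Rle_div_r; lra.
  rewrite /Rdiv; nra.
Qed.

Lemma mean_ge (N M : nat) : (M <= N)%nat -> INR M <= X -> INR M * (X ^ k / 4) <= mean N.
Proof.
  move=> HMN HM; rewrite -rsum_const.
  apply: (Rle_trans _ (mean M)).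
    apply: rsum_le => m [H1 H2]; apply: mean_term_ge => //.
    by have := le_INR _ _ H2; lra.
  apply: rsum_le_range => // m Hm; have Hr := boltz_pow_range m Hm.
  apply: Rmult_le_pos; first by apply: pow_le; apply: pos_INR.
  by apply: Rdiv_le_0_compat; lra.
Qed.

Lemma argument_approx (N : nat) (t : R) :
  Rabs (argument e x N t - mean N * t) <= 12500 * X * (Rabs t * X ^ k) ^ 3.
Proof.
  have HX := Xk_gt0.
  have -> : argument e x N t - mean N * t =
    rsum (fun m => phase (r m) (INR (m ^ k) * t) - r m / (1 - r m) * (INR (m ^ k) * t)) N.
    rewrite rsum_minus (Rmult_comm _ t) /mean -rsum_scal; congr (_ - _).
    by apply: rsum_ext => m _; rewrite pow_INR; ring.
  apply: Rle_trans (rsum_abs _ _) _.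
  apply: (Rle_trans _ ((Rabs t * X ^ k) ^ 3 * rsum (fun m => 3125 / (1 + INR m ^ k * x) ^ 2) N)).
    rewrite -rsum_scal; apply: rsum_le => m [Hm _].
    have Hr := boltz_pow_range m Hm.
    apply: Rle_trans (phase_linear_approx _ _ Hr) _.
    have -> : r m * Rabs (INR (m ^ k) * t) ^ 3 / (1 - r m) ^ 3 =
      (Rabs t * X ^ k) ^ 3 * (r m * ((INR m ^ k * x) / (1 - r m)) ^ 3).
      rewrite Rabs_mult (Rabs_pos_eq (INR _)); last exact: pos_INR.
      by rewrite pow_INR; field; lra.
    apply: Rmult_le_compat_l; last by apply: weight_le.
    by apply: pow_le; apply: Rmult_le_pos; [apply: Rabs_pos | lra].
  have := sum_weight_le N.
  have : 0 <= (Rabs t * X ^ k) ^ 3.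
    by apply: pow_le; apply: Rmult_le_pos; [apply: Rabs_pos | lra].
  nra.
Qed.

Lemma amplitude_ge (N : nat) (t : R) :
  exp (- (12500 * X * (t * X ^ k) ^ 2)) <= amplitude e x N t.
Proof.
  have HX := Xk_gt0.
  apply: (Rle_trans _ (exp (- rsum (fun m => r m * (INR (m ^ k) * t) ^ 2 / (1 - r m) ^ 2) N))).
    have H : rsum (fun m => r m * (INR (m ^ k) * t) ^ 2 / (1 - r m) ^ 2) N <=
        12500 * X * (t * X ^ k) ^ 2.
      apply: (Rle_trans _ ((t * X ^ k) ^ 2 * rsum (fun m => 3125 / (1 + INR m ^ k * x) ^ 2) N)).
        rewrite -rsum_scal; apply: rsum_le => m [Hm _]; have Hr := boltz_pow_range m Hm.
        have -> : r m * (INR (m ^ k) * t) ^ 2 / (1 - r m) ^ 2 =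
          (t * X ^ k) ^ 2 * (r m * ((INR m ^ k * x) / (1 - r m)) ^ 2).
          by rewrite pow_INR; field; lra.
        apply: Rmult_le_compat_l; first exact: pow2_ge_0.
        by apply: weight_le => //; lia.
      have := sum_weight_le N; have := pow2_ge_0 (t * X ^ k); nra.
    case: H => [H|->]; last by right.
    by left; apply: exp_increasing; lra.
  rewrite /amplitude; elim: N => [|N IH]; first by rewrite /= Ropp_0 exp_0; lra.
  have -> : forall f, rsum f (S N) = rsum f N + f (S N) by [].
  have -> : forall f, rprod f (S N) = rprod f N * f (S N) by [].
  rewrite Ropp_plus_distr exp_plus.
  apply: Rmult_le_compat; try (left; exact: exp_pos); first exact: IH.
  by apply: modulus_ge; apply: boltz_pow_range; lia.
Qed.

(** Factors beyond [M] are at most 1 and are dropped; for [m <= M <= X] the ratio is at least 1/4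
    and [modulus_le] applies. *)
Lemma amplitude_le (N M : nat) (t : R) : (M <= N)%nat -> INR M <= X ->
  amplitude e x N t <= exp (- (rsum (fun m => 1 - cos (INR m ^ k * t)) M / 8)).
Proof.
  move=> HMN HM.
  apply: (Rle_trans _ (amplitude e x M t)).
    elim: N HMN => [|N IH] HMN; first by replace M with 0%nat by lia; right.
    case: (Nat.eq_dec M (S N)) => [->|Hne]; first by right.
    apply: Rle_trans (IH ltac:(lia)).
    have [A _] := amplitude_bounds e x pow_ge1 inv_Xk_gt0 N t.
    have := modulus_le1 _ (INR (S N ^ k) * t) (boltz_pow_range (S N) ltac:(lia)).
    rewrite /amplitude [rprod _ (S N)]/= -/(amplitude e x N t); nra.
  rewrite /amplitude; elim: M HM {HMN} => [|M IH] HM.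
    by rewrite /= /Rdiv Rmult_0_l Ropp_0 exp_0; lra.
  have HM' : INR M <= X by rewrite S_INR in HM; lra.
  have Hr := boltz_pow_range (S M) ltac:(lia).
  have -> : forall f, rsum f (S M) = rsum f M + f (S M) by [].
  have -> : forall f, rprod f (S M) = rprod f M * f (S M) by [].
  rewrite Rdiv_plus_distr Ropp_plus_distr exp_plus.
  apply: Rmult_le_compat.
  - by have [] := amplitude_bounds e x pow_ge1 inv_Xk_gt0 M t.
  - exact: modulus_ge0.
  - exact: IH.
  - rewrite -pow_INR; apply: modulus_le; split; last lra.
    by apply: boltz_ge_quarter => //; lia.
Qed.

End PowerWeights.

(** * The integrals near the saddle point *)

Lemma RInt_le_three (g : R -> R) (a u v b c1 c2 c3 : R) :
  (forall t, continuous g t) -> a <= u <= v -> v <= b ->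
  (forall t, a <= t <= u -> g t <= c1) ->
  (forall t, u <= t <= v -> g t <= c2) ->
  (forall t, v <= t <= b -> g t <= c3) ->
  RInt g a b <= c1 * (u - a) + c2 * (v - u) + c3 * (b - v).
Proof.
  move=> Hg Hau Hvb H1 H2 H3.
  have ex a' b' : ex_RInt g a' b' by apply: ex_RInt_continuous => t _; apply: Hg.
  have step a' b' c : a' <= b' -> (forall t, a' <= t <= b' -> g t <= c) ->
      RInt g a' b' <= c * (b' - a').
    move=> Hab Hc.
    have -> : c * (b' - a') = RInt (fun _ => c) a' b'.
      by rewrite RInt_const /scal /= /mult /=; ring.
    apply: RInt_le => //; first exact: ex_RInt_const.
    by move=> t Ht; apply: Hc; lra.
  rewrite -(RInt_Chasles g a u b) // -(RInt_Chasles g u v b) //.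
  have S1 := step a u c1 (proj1 Hau) H1.
  have S2 := step u v c2 (proj2 Hau) H2.
  have S3 := step v b c3 Hvb H3.
  rewrite /plus /=; lra.
Qed.

Lemma RInt_ge_three (g : R -> R) (a u v b c1 c2 c3 : R) :
  (forall t, continuous g t) -> a <= u <= v -> v <= b ->
  (forall t, a <= t <= u -> c1 <= g t) ->
  (forall t, u <= t <= v -> c2 <= g t) ->
  (forall t, v <= t <= b -> c3 <= g t) ->
  c1 * (u - a) + c2 * (v - u) + c3 * (b - v) <= RInt g a b.
Proof.
  move=> Hg Hau Hvb H1 H2 H3.
  have ex : ex_RInt g a b by apply: ex_RInt_continuous => t _; apply: Hg.
  have := RInt_le_three (fun t => - g t) a u v b (- c1) (- c2) (- c3)
    (fun t => continuous_opp g t (Hg t)) Hau Hvb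
    (fun t Ht => Ropp_le_contravar _ _ (H1 t Ht))
    (fun t Ht => Ropp_le_contravar _ _ (H2 t Ht))
    (fun t Ht => Ropp_le_contravar _ _ (H3 t Ht)).
  have -> : RInt (fun t => - g t) a b = - RInt g a b by apply: (RInt_opp g).
  lra.
Qed.

Lemma RInt_le_affine (f g : R -> R) (c d : R) :
  (forall t, continuous f t) -> (forall t, continuous g t) ->
  (forall t, - PI <= t <= PI -> f t <= c * g t + d) ->
  RInt f (- PI) PI <= c * RInt g (- PI) PI + 2 * PI * d.
Proof.
  move=> Hf Hg H; have HP := PI_RGT_0.
  have exf : ex_RInt f (- PI) PI by apply: ex_RInt_continuous => t _; apply: Hf.
  have exg : ex_RInt g (- PI) PI by apply: ex_RInt_continuous => t _; apply: Hg.
  have A := is_RInt_plus _ _ _ _ _ _ (is_RInt_scal _ _ _ c _ (RInt_correct _ _ _ exg))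
    (is_RInt_const (- PI) PI d).
  have H' t : - PI < t < PI -> f t <= plus (scal c (g t)) d by move=> Ht; apply: H; lra.
  have HPP : - PI <= PI by lra.
  have := is_RInt_le _ _ _ _ _ _ HPP (RInt_correct _ _ _ exf) A H'.
  rewrite /plus /scal /= /mult /=; lra.
Qed.

Section SaddlePoint.

Variables (A psi : R -> R) (eta zeta kappa T : R).
Hypotheses (A_cont : forall t, continuous A t) (psi_cont : forall t, continuous psi t)
  (A_range : forall t, 0 <= A t <= 1)
  (zeta_eta : 0 < zeta <= eta) (eta_le1 : eta <= 1) (kappa_gt0 : 0 < kappa) (T_ge0 : 0 <= T)
  (psi_center : forall t, Rabs t <= eta -> / 2 <= cos (psi t))
  (A_tail : forall t, eta <= Rabs t <= PI -> A t <= T)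
  (A_center : forall t, Rabs t <= zeta -> kappa <= A t).

Definition int_cos : R := RInt (fun t => A t * cos (psi t)) (- PI) PI.
Definition int_var : R := RInt (fun t => A t * cos (psi t) * (1 - cos t)) (- PI) PI.
Definition int_sin : R := RInt (fun t => A t * sin (psi t) * sin t) (- PI) PI.

Lemma cos_psi_continuous (t : R) : continuous (fun t => A t * cos (psi t)) t.
Proof.
  apply: (continuous_mult A) => //.
  by apply: (continuous_comp psi cos) => //; apply: continuous_cos.
Qed.

Lemma var_continuous (t : R) : continuous (fun t => A t * cos (psi t) * (1 - cos t)) t.
Proof.
  apply: (continuous_mult (fun t => A t * cos (psi t))); first exact: cos_psi_continuous.
  by apply: (continuous_minus (fun _ => 1) cos); [apply: continuous_const | apply: continuous_cos].
Qed.

Lemma sin_psi_continuous (t : R) : continuous (fun t => A t * sin (psi t) * sin t) t.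
Proof.
  apply: (continuous_mult (fun t => A t * sin (psi t))); last exact: continuous_sin.
  apply: (continuous_mult A) => //.
  by apply: (continuous_comp psi sin) => //; apply: continuous_sin.
Qed.

Lemma tail_bound (t c : R) : eta <= Rabs t <= PI -> Rabs c <= 1 -> Rabs (A t * c) <= T.
Proof.
  move=> Ht Hc; rewrite Rabs_mult Rabs_pos_eq; last by have := A_range t; lra.
  have := A_tail t Ht; have := A_range t; have := Rabs_pos c; nra.
Qed.

Lemma Rabs_cos_le1 (t : R) : Rabs (cos t) <= 1.
Proof. by have := COS_bound t; move=> H; apply: Rabs_le; lra. Qed.

Lemma Rabs_sin_le1 (t : R) : Rabs (sin t) <= 1.
Proof. by have := SIN_bound t; move=> H; apply: Rabs_le; lra. Qed.

Lemma A_cos_lower (t : R) : Rabs t <= PI -> - T <= A t * cos (psi t).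
Proof.
  move=> Ht; have HA := A_range t; case: (Rle_lt_dec (Rabs t) eta) => H.
    have := psi_center t H; nra.
  have := tail_bound t (cos (psi t)) ltac:(lra) (Rabs_cos_le1 _).
  by move=> /Rabs_le_between; lra.
Qed.

Lemma PI_gt1 : 1 < PI.
Proof. by have := PI2_1; lra. Qed.

Lemma int_cos_ge : kappa * zeta / 2 - 2 * PI * T <= int_cos.
Proof.
  have HP := PI_gt1.
  have := RInt_ge_three (fun t => A t * cos (psi t)) (- PI) 0 zeta PI (- T) (kappa / 2) (- T)
    cos_psi_continuous ltac:(lra) ltac:(lra).
  rewrite -/int_cos => H.
  apply: Rle_trans (H _ _ _); first nra.
  - by move=> t Ht; apply: A_cos_lower; apply: Rabs_le; lra.
  - move=> t Ht; have Hz : Rabs t <= zeta by apply: Rabs_le; lra.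
    have := A_center t Hz; have := psi_center t ltac:(lra); nra.
  - by move=> t Ht; apply: A_cos_lower; apply: Rabs_le; lra.
Qed.

Lemma int_cos_le : int_cos <= 2 * eta + 2 * PI * T.
Proof.
  have HP := PI_gt1.
  have tail t : eta <= Rabs t <= PI -> A t * cos (psi t) <= T.
    by move=> Ht; have /Rabs_le_between := tail_bound t (cos (psi t)) Ht (Rabs_cos_le1 _); lra.
  have := RInt_le_three (fun t => A t * cos (psi t)) (- PI) (- eta) eta PI T 1 T
    cos_psi_continuous ltac:(lra) ltac:(lra).
  rewrite -/int_cos => H.
  apply: Rle_trans (H _ _ _) _; last nra.
  - by move=> t Ht; apply: tail; rewrite Rabs_left1; lra.
  - move=> t Ht; have := A_range t; have := COS_bound (psi t); nra.
  - by move=> t Ht; apply: tail; rewrite Rabs_pos_eq; lra.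
Qed.

Lemma int_var_ge : kappa * zeta ^ 3 / 64 - 4 * PI * T <= int_var.
Proof.
  have HP := PI_gt1.
  have low t : - PI <= t <= PI -> - (2 * T) <= A t * cos (psi t) * (1 - cos t).
    move=> Ht; have := A_cos_lower t ltac:(by apply: Rabs_le; lra).
    have := COS_bound t; nra.
  (* On [[zeta / 2, zeta]] one has [1 - cos t >= zeta^2 / 16]; with [A t * cos (psi t) >= kappa / 2]
     and length [zeta / 2] this gives the main term. *)
  have := RInt_ge_three (fun t => A t * cos (psi t) * (1 - cos t)) (- PI) (zeta / 2) zeta PI
    (- (2 * T)) (kappa / 2 * (zeta ^ 2 / 16)) (- (2 * T))
    var_continuous ltac:(lra) ltac:(lra).
  rewrite -/int_var => H.
  apply: Rle_trans (H _ _ _); first nra.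
  - by move=> t Ht; apply: low; lra.
  - move=> t Ht; have Hz : Rabs t <= zeta by apply: Rabs_le; lra.
    have H1 := A_center t Hz; have H2 := psi_center t ltac:(lra).
    have H3 := one_minus_cos_ge t ltac:(lra).
    apply: Rmult_le_compat; [lra | nra | nra | nra].
  - by move=> t Ht; apply: low; lra.
Qed.

(** The integrands are compared pointwise. In the centre [A t * cos (psi t)] is nonnegative; in the
    tail the left side is at most [2 T] and the right side loses at most [T]. *)
Lemma int_var_le : int_var <= eta ^ 2 * int_cos + 6 * PI * T.
Proof.
  have HP := PI_gt1.
  have -> : 6 * PI * T = 2 * PI * (3 * T) by ring.
  apply: RInt_le_affine; [exact: var_continuous | exact: cos_psi_continuous |].
  move=> t Ht; have HA := A_range t; have HC := COS_bound t.
  case: (Rle_lt_dec (Rabs t) eta) => H.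
    have H1 := psi_center t H; have H2 := one_minus_cos_le t.
    have H3 : t ^ 2 <= eta ^ 2.
      by rewrite -(pow2_abs t); apply: pow_incr; split=> //; apply: Rabs_pos.
    have H4 : 0 <= A t * cos (psi t) by nra.
    have := pow2_ge_0 t; nra.
  have := tail_bound t (cos (psi t)) ltac:(by split; [lra | apply: Rabs_le; lra]) (Rabs_cos_le1 _).
  move=> /Rabs_le_between; move: (A t * cos (psi t)) => w Hw.
  have : eta ^ 2 <= 1 by nra.
  have := pow2_ge_0 eta; move: (eta ^ 2) => q Hq0 Hq1.
  nra.
Qed.

(** In the centre [|sin psi| <= 1 <= 2 cos psi] and [|sin t| <= eta], so no smallness of [sin psi]
    is used. *)
Lemma int_sin_le : Rabs int_sin <= 2 * eta * int_cos + 6 * PI * T.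
Proof.
  have HP := PI_gt1.
  have -> : 6 * PI * T = 2 * PI * (3 * T) by ring.
  have key t s : - PI <= t <= PI -> Rabs s = 1 ->
      s * (A t * sin (psi t) * sin t) <= 2 * eta * (A t * cos (psi t)) + 3 * T.
    move=> Ht Hs; have HA := A_range t.
    apply: Rle_trans (Rle_abs _) _; rewrite !Rabs_mult Hs Rmult_1_l (Rabs_pos_eq (A t)); last lra.
    have H1 := Rabs_sin_le1 (psi t); have H2 := Rabs_sin_le1 t.
    have P1 := Rabs_pos (sin (psi t)); have P2 := Rabs_pos (sin t).
    case: (Rle_lt_dec (Rabs t) eta) => H.
      have H3 := psi_center t H.
      have H4 : Rabs (sin t) <= eta.
        apply: Rle_trans H.
        have E := one_minus_cos_le (2 * t); rewrite one_minus_cos in E.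
        have E2 : 2 * t / 2 = t by field.
        rewrite E2 in E.
        apply: Rsqr_incr_0; [|exact: Rabs_pos|exact: Rabs_pos].
        by rewrite -!Rsqr_abs /Rsqr; lra.
      have H5 : A t * Rabs (sin (psi t)) * Rabs (sin t) <= A t * 1 * eta.
        apply: Rmult_le_compat => //; first by apply: Rmult_le_pos; lra.
        by apply: Rmult_le_compat_l; lra.
      have : A t * eta <= A t * eta * (2 * cos (psi t)).
        rewrite -{1}[A t * eta]Rmult_1_r; apply: Rmult_le_compat_l; last lra.
        by apply: Rmult_le_pos; lra.
      lra.
    have Ht' : eta <= Rabs t <= PI by split; [lra | apply: Rabs_le; lra].
    have := tail_bound t (cos (psi t)) Ht' (Rabs_cos_le1 _).
    have HT := A_tail t Ht'.
    move=> /Rabs_le_between; move: (A t * cos (psi t)) => w Hw.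
    have : A t * Rabs (sin (psi t)) * Rabs (sin t) <= A t * 1 * 1.
      apply: Rmult_le_compat => //; first by apply: Rmult_le_pos; lra.
      by apply: Rmult_le_compat_l; lra.
    nra.
  apply: Rabs_le; split.
    have := RInt_le_affine (fun t => - (A t * sin (psi t) * sin t)) (fun t => A t * cos (psi t))
      (2 * eta) (3 * T) (fun t => continuous_opp _ _ (sin_psi_continuous t)) cos_psi_continuous.
    have -> : RInt (fun t => - (A t * sin (psi t) * sin t)) (- PI) PI = - int_sin.
      apply: (RInt_opp (fun t => A t * sin (psi t) * sin t)).
      by apply: ex_RInt_continuous => t _; apply: sin_psi_continuous.
    move=> H; have : - int_sin <= 2 * eta * int_cos + 2 * PI * (3 * T).
      apply: H => t Ht; have := key t (-1) Ht; rewrite Rabs_left; lra.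
    lra.
  apply: RInt_le_affine; [exact: sin_psi_continuous | exact: cos_psi_continuous |].
  move=> t Ht; have := key t 1 Ht; rewrite Rabs_R1; lra.
Qed.

(** All tail errors are at most [6 pi T <= 24 T <= tau], where [tau] is half the main term of
    [int_var] and at most [eta^2 * int_cos]. Thus [|int_sin| <= 3 eta * int_cos], whence
    [192 = 3 * 64], and [int_cos <= 3 eta < n^2 tau]. *)
Lemma saddle_integrals (x n : R) :
  kappa <= 1 -> eta <= x / 192 -> 24 * T <= kappa * zeta ^ 3 / 128 ->
  3 * 128 * eta < n ^ 2 * (kappa * zeta ^ 3) ->
  0 < int_cos /\ 0 < int_var <= x ^ 2 / 64 * int_cos /\
  Rabs int_sin <= x / 64 * int_cos /\ int_cos < n ^ 2 * int_var.
Proof.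
  move=> Hk1 Hex HT Hn; have HP := PI_4; have HP1 := PI_gt1.
  have C1 := int_cos_ge; have C2 := int_cos_le; have C3 := int_var_ge.
  have C4 := int_var_le; have C5 := int_sin_le.
  have HPT : PI * T <= 4 * T by nra.
  set tau := kappa * zeta ^ 3 / 128 in HT.
  have Hz2 : zeta ^ 2 <= eta ^ 2 by apply: pow_incr; lra.
  have He2 : eta ^ 2 <= eta by nra.
  have Hkz : 0 < kappa * zeta by apply: Rmult_lt_0_compat; lra.
  have Htau : tau = kappa * zeta / 4 * (zeta ^ 2 / 32) by rewrite /tau; field.
  have Htau0 : 0 < tau.
    by rewrite /tau; apply: Rdiv_lt_0_compat; last lra; apply: Rmult_lt_0_compat => //; apply: pow_lt; lra.
  have Htau1 : tau <= kappa * zeta / 4.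
    rewrite Htau -{2}[kappa * zeta / 4]Rmult_1_r; apply: Rmult_le_compat_l; lra.
  have Ia : kappa * zeta / 4 <= int_cos by lra.
  have Htau2 : tau <= eta ^ 2 * int_cos.
    have Hz20 := pow2_ge_0 zeta.
    by rewrite Htau Rmult_comm; apply: Rmult_le_compat; lra.
  have Hkze : kappa * zeta <= eta by nra.
  have Ib : tau <= int_var by rewrite /tau in HT *; lra.
  have Ia0 : 0 < int_cos by lra.
  have Hee : eta ^ 2 * int_cos <= eta * int_cos by apply: Rmult_le_compat_r; lra.
  split=> //; split; first split; [lra | | split].
  - have : 2 * eta ^ 2 * int_cos <= x ^ 2 / 64 * int_cos.
      by apply: Rmult_le_compat_r; [lra | nra].
    lra.
  - have : 3 * eta * int_cos <= x / 64 * int_cos by apply: Rmult_le_compat_r; lra.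
    lra.
  - have : n ^ 2 * tau <= n ^ 2 * int_var.
      by apply: Rmult_le_compat_l => //; apply: pow2_ge_0.
    have : 3 * eta < n ^ 2 * tau by rewrite /tau; lra.
    lra.
Qed.

End SaddlePoint.

(** * From the integrals to the two inequalities *)

Lemma sinh_bounds (x : R) : 0 <= x <= / 2 ->
  0 <= exp x - exp (- x) <= 3 * x /\ 2 + x ^ 2 / 4 <= exp x + exp (- x).
Proof.
  move=> Hx.
  have H1 := exp_ineq1_le x; have H2 := exp_ineq1_le (- x).
  have H3 := exp_ineq1_le (x / 2).
  have E1 : exp x = exp (x / 2) ^ 2 by rewrite /= Rmult_1_r -exp_plus; congr exp; field.
  have E2 : exp (x / 2) * exp (- (x / 2)) = 1.
    by rewrite -exp_plus -exp_0; congr exp; ring.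
  have E3 : exp (- x) = exp (- (x / 2)) ^ 2 by rewrite /= Rmult_1_r -exp_plus; congr exp; field.
  have E4 : exp x * exp (- x) = 1 by rewrite -exp_plus -exp_0; congr exp; ring.
  have P1 := exp_pos (- (x / 2)); have P2 := exp_pos (- x).
  have H4 : exp (- (x / 2)) <= 1 by nra.
  have H5 : exp (- x) <= 1 by nra.
  have H6 : exp x <= 1 + 2 * x by nra.
  split; first lra.
  (* The square on the right equals [exp x + exp (- x) - 2]. *)
  have : (x / 2) ^ 2 <= (exp (x / 2) - exp (- (x / 2))) ^ 2 by apply: pow_incr; lra.
  rewrite E1 E3; nra.
Qed.

(* [G] is the common normalisation of the three Fourier integrals at [n], [n + 1], [n - 1]. *)
Lemma inequalities_of_integrals (G x n p pp pm a b s : R) :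
  0 < G -> 0 < x <= / 2 -> 20 <= n ^ 2 * x ^ 2 ->
  G * p = a -> G * pp = exp x * (a - b + s) -> G * pm = exp (- x) * (a - b - s) ->
  0 < a -> 0 < b <= x ^ 2 / 64 * a -> Rabs s <= x / 64 * a -> a < n ^ 2 * b ->
  2 * p * n ^ 2 < (pp + pm) * (n ^ 2 - 1) /\ pp * pm * (n ^ 2 + 1) < p ^ 2 * n ^ 2.
Proof.
  move=> HG Hx Hnx Ep Epp Epm Ha Hb Hs Hab.
  have Hx2 : 0 < x ^ 2 <= / 4 by nra.
  have Hba : b <= a / 256 by nra.
  have Hn0 := pow2_ge_0 n.
  have Hn : 20 <= n ^ 2 by nra.
  have [S1 S2] := sinh_bounds x ltac:(lra).
  have E4 : exp x * exp (- x) = 1 by rewrite -exp_plus -exp_0; congr exp; ring.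
  split.
    apply: (Rmult_lt_reg_l G) => //.
    have -> : G * (2 * p * n ^ 2) = 2 * a * n ^ 2 by rewrite -Ep; ring.
    have -> : G * ((pp + pm) * (n ^ 2 - 1)) =
      ((exp x + exp (- x)) * (a - b) + (exp x - exp (- x)) * s) * (n ^ 2 - 1).
      transitivity ((G * pp + G * pm) * (n ^ 2 - 1)); first ring.
      by rewrite Epp Epm; ring.
    have H1 : (2 + x ^ 2 / 4) * (a - b) <= (exp x + exp (- x)) * (a - b).
      by apply: Rmult_le_compat_r; lra.
    have H2 : - (3 * x * (x / 64 * a)) <= (exp x - exp (- x)) * s.
      have : Rabs ((exp x - exp (- x)) * s) <= 3 * x * (x / 64 * a).
        rewrite Rabs_mult (Rabs_pos_eq (exp x - _)); last lra.
        by apply: Rmult_le_compat; [lra | apply: Rabs_pos | lra | lra].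
      by move=> /Rabs_le_between; lra.
    (* Of the gain [x^2 a / 4], the terms with [b] and [s] take at most [3 x^2 a / 64] each. *)
    have H3 : a * (2 + x ^ 2 / 8) <= (exp x + exp (- x)) * (a - b) + (exp x - exp (- x)) * s.
      have H5 : b * (2 + x ^ 2 / 4) <= x ^ 2 / 64 * a * 3.
        apply: Rmult_le_compat; lra.
      lra.
    have H4 : 2 * a * n ^ 2 < a * (2 + x ^ 2 / 8) * (n ^ 2 - 1).
      (* [n^2 x^2 / 8 >= 5/2] exceeds [2 + x^2 / 8]. *)
      have : 2 * n ^ 2 < (2 + x ^ 2 / 8) * (n ^ 2 - 1) by nra.
      move=> H; have := Rmult_lt_compat_l a _ _ Ha H; lra.
    apply: Rlt_le_trans H4 _.
    by apply: Rmult_le_compat_r; lra.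
  apply: (Rmult_lt_reg_l (G ^ 2)); first by apply: pow_lt.
  have -> : G ^ 2 * (p ^ 2 * n ^ 2) = a ^ 2 * n ^ 2 by rewrite -Ep; ring.
  have -> : G ^ 2 * (pp * pm * (n ^ 2 + 1)) = ((a - b) ^ 2 - s ^ 2) * (n ^ 2 + 1).
    transitivity ((G * pp) * (G * pm) * (n ^ 2 + 1)); first ring.
    rewrite Epp Epm.
    transitivity ((exp x * exp (- x)) * ((a - b) ^ 2 - s ^ 2) * (n ^ 2 + 1)); first ring.
    by rewrite E4; ring.
  apply: (Rle_lt_trans _ ((a ^ 2 - a * b) * (n ^ 2 + 1))).
    apply: Rmult_le_compat_r; first lra.
    have := pow2_ge_0 s; nra.
  have := Rmult_lt_compat_l a _ _ Ha Hab; nra.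
Qed.

(** [exp (c Z^2) >= exp (c Z) >= (c Z / (d + 1))^(d + 1)] has one power of [Z] to spare, and that
    power beats [1 / eps]. *)
Lemma exp_neg_sq_le_inv_pow (c eps : R) (d : nat) : 0 < c -> 0 < eps ->
  exists Z0 : R, 1 <= Z0 /\ forall Z, Z0 <= Z -> exp (- (c * Z ^ 2)) <= eps / Z ^ d.
Proof.
  move=> Hc He.
  have Hd : 0 < INR (S d) by apply: lt_0_INR; lia.
  set K := (INR (S d) / c) ^ S d.
  have HK : 0 < K by apply: pow_lt; apply: Rdiv_lt_0_compat.
  have HKe : 0 < K / eps by apply: Rdiv_lt_0_compat.
  exists (1 + K / eps); split; first lra.
  move=> Z HZ; have HZ1 : 1 <= Z by lra.
  have HZd : 0 < Z ^ d by apply: pow_lt; lra.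
  have Hu : 0 < c * Z / INR (S d) by apply: Rdiv_lt_0_compat => //; nra.
  have H1 : (c * Z / INR (S d)) ^ S d <= exp (c * Z ^ 2).
    apply: (Rle_trans _ (exp (c * Z / INR (S d)) ^ S d)).
      by apply: pow_incr; have := exp_ineq1_le (c * Z / INR (S d)); lra.
    rewrite -Rpower_pow; last exact: exp_pos.
    rewrite /Rpower ln_exp.
    have -> : INR (S d) * (c * Z / INR (S d)) = c * Z by field; lra.
    have : c * Z <= c * Z ^ 2 by apply: Rmult_le_compat_l; [lra | nra].
    case=> [H|->]; last by right.
    by left; apply: exp_increasing.
  have H2 : (c * Z / INR (S d)) ^ S d * K = Z ^ S d.
    rewrite /K -Rpow_mult_distr; congr (_ ^ _); field; lra.
  have H3 : Z ^ S d = Z * Z ^ d by [].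
  have H4 : K <= eps * Z.
    have : K / eps <= Z by lra.
    by move/(Rle_div_l _ _ _ He); lra.
  apply: (proj1 (Rle_div_r _ _ _ HZd)); rewrite exp_Ropp.
  have Hp := exp_pos (c * Z ^ 2).
  rewrite Rmult_comm; apply: (proj2 (Rle_div_l _ _ _ Hp)).
  apply: (Rmult_le_reg_r Z); first lra.
  have -> : Z ^ d * Z = (c * Z / INR (S d)) ^ S d * K by rewrite H2 H3; ring.
  have H5 : (c * Z / INR (S d)) ^ S d * K <= exp (c * Z ^ 2) * K.
    by apply: Rmult_le_compat_r; lra.
  have : exp (c * Z ^ 2) * K <= exp (c * Z ^ 2) * (eps * Z) by apply: Rmult_le_compat_l; lra.
  lra.
Qed.

(** Apply [cos_sum_lower_bound] with [M] the floor of [X = Z^6]: on this range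
    [|t| X^k >= 1 / (25 Z^2)], so the exponent is of order [X / Z^4 = Z^2]. Passing from [X] to
    [M >= X / 2] costs the powers of 2. *)
Lemma amplitude_tail (k : nat) : (1 <= k)%nat ->
  exists c Z1 : R, 0 < c /\ 2 <= Z1 /\ forall (Z t : R) (N : nat),
    Z1 <= Z -> Z ^ 6 < INR N + 1 -> / (25 * Z ^ 2 * (Z ^ 6) ^ k) <= Rabs t <= PI ->
    amplitude (fun m => (m ^ k)%nat) (/ (Z ^ 6) ^ k) N t <= exp (- (c * Z ^ 2)).
Proof.
  move=> Hk; have [c [M0 [Hc HS]]] := cos_sum_lower_bound k Hk.
  have H2 : 0 < 2 ^ k by apply: pow_lt; lra.
  have H4 : 0 < (2 ^ k) ^ 2 by apply: pow_lt.
  exists (c / (10000 * (2 ^ k) ^ 2)), (INR M0 + 2); split.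
    by apply: Rdiv_lt_0_compat; lra.
  have HM0 := pos_INR M0; split; first lra.
  move=> Z t N HZ HN Ht.
  have HZ6 : Z <= Z ^ 6 by rewrite -{1}[Z]pow_1; apply: Rle_pow; [lra | lia].
  set X := Z ^ 6 in HZ6 HN Ht *.
  have [M [HM1 HM2]] := nfloor_ex X ltac:(lra).
  have HMN : (M <= N)%nat.
    have : INR M < INR (N + 1) by rewrite plus_INR [INR 1]/=; lra.
    by move/INR_lt; lia.
  have HMM : (M0 <= M)%nat.
    have : INR M0 < INR (M + 1) by rewrite plus_INR [INR 1]/=; lra.
    by move/INR_lt; lia.
  have HX1 : 1 <= X by lra.
  apply: Rle_trans (amplitude_le k X Hk HX1 N M t HMN HM1) _.
  have HZ2 : 0 < Z ^ 2 by apply: pow_lt; lra.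
  have HXk := Xk_gt0 k X HX1.
  set q := 25 * Z ^ 2 * 2 ^ k.
  have Hq1 : 1 <= q.
    have := pow_R1_Rle 2 k ltac:(lra); have : 1 <= Z ^ 2 by apply: pow_R1_Rle; lra.
    rewrite /q; nra.
  have Htq : / q <= Rabs t * INR M ^ k.
    have HMX : X ^ k <= 2 ^ k * INR M ^ k.
      by rewrite -Rpow_mult_distr; apply: pow_incr; lra.
    have H5 : / (25 * Z ^ 2 * X ^ k) * (X ^ k / 2 ^ k) <= Rabs t * INR M ^ k.
      apply: Rmult_le_compat.
      - by left; apply: Rinv_0_lt_compat; nra.
      - by left; apply: Rdiv_lt_0_compat.
      - lra.
      - by apply: (proj2 (Rle_div_l _ _ _ H2)); lra.
    apply: Rle_trans H5; right; rewrite /q; field; lra.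
  have Hq0 : 0 < / q by apply: Rinv_0_lt_compat; lra.
  have Hmin : (/ q) ^ 2 <= Rmin 1 ((t * INR M ^ k) ^ 2).
    apply: Rmin_glb.
      have : / q <= / 1 by apply: Rinv_le_contravar; lra.
      nra.
    rewrite -(pow2_abs (t * _)) Rabs_mult (Rabs_pos_eq (_ ^ k)); last first.
      by apply: pow_le; apply: pos_INR.
    by apply: pow_incr; lra.
  have HSM := HS M t HMM ltac:(lra).
  have HcM : c * (X / 2) * (/ q) ^ 2 <= c * INR M * Rmin 1 ((t * INR M ^ k) ^ 2).
    apply: Rmult_le_compat => //.
    - by apply: Rmult_le_pos; lra.
    - exact: pow2_ge_0.
    - by apply: Rmult_le_compat_l; lra.
  have E1 : c * (X / 2) * (/ q) ^ 2 = 8 * (c / (10000 * (2 ^ k) ^ 2) * Z ^ 2).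
    by rewrite /X /q; field; lra.
  have H6 : c / (10000 * (2 ^ k) ^ 2) * Z ^ 2 <= rsum (fun m => 1 - cos (INR m ^ k * t)) M / 8 by lra.
  case: H6 => [H6|->]; last by right.
  by left; apply: exp_increasing; lra.
Qed.

(** * Existence and size of the saddle point *)

Lemma mean_continuous (k N : nat) (u : R) : (1 <= k)%nat ->
  continuous (fun u => mean k (exp u) N) u.
Proof.
  move=> Hk; rewrite /mean; elim: N => [|N IH]; first exact: continuous_const.
  apply: (continuous_plus (fun u => rsum (fun m => INR m ^ k *
    (boltz (fun m : nat => (m ^ k)%nat) (/ exp u ^ k) m /
    (1 - boltz (fun m : nat => (m ^ k)%nat) (/ exp u ^ k) m))) N)) => //.
  have HX : 0 < exp u ^ k by apply: pow_lt; apply: exp_pos.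
  have Hb := boltz_bounds (fun m : nat => (m ^ k)%nat) (/ exp u ^ k) (S N)
    (pow_ge1 k (S N) ltac:(lia)) (Rinv_0_lt_compat _ HX).
  apply: ex_derive_continuous; rewrite /boltz in Hb *; move: (INR (S N ^ k)) Hb => y Hb.
  auto_derive; split; [|split]; try lra.
Qed.

Lemma exists_saddle_point (k N n : nat) (X0 : R) : (1 <= k)%nat -> (1 <= N)%nat ->
  1 <= X0 -> mean k X0 N <= INR n ->
  exists X, X0 <= X /\ mean k X N = INR n.
Proof.
  move=> Hk HN HX0 H0; have Hn := pos_INR n.
  (* The first term of the mean alone is at least [X1^k / 4 >= n]. *)
  set X1 := X0 + 4 * INR n.
  have H1 : INR n <= mean k X1 N.
    have HX1 : 1 <= X1 by rewrite /X1; lra.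
    have := mean_ge k X1 Hk HX1 N 1 HN ltac:(rewrite [INR 1]/=; lra).
    have := Rle_pow X1 1 k HX1 Hk; rewrite pow_1 [INR 1]/= /X1; lra.
  have Hln : ln X0 <= ln X1.
    have [H|H] : X0 <= X1 by rewrite /X1; lra.
      by left; apply: ln_increasing; lra.
    by rewrite -H; right.
  have E X : 1 <= X -> exp (ln X) = X by move=> H; apply: exp_ln; lra.
  (* The substitution [X = exp u] gives continuity on the whole line, the form in which [IVT_gen]
     takes it. *)
  have Hc : continuity (fun u => mean k (exp u) N).
    by move=> u; apply/continuity_pt_filterlim; apply: mean_continuous.
  have Hv : Rmin (mean k (exp (ln X0)) N) (mean k (exp (ln X1)) N) <= INR n <=
      Rmax (mean k (exp (ln X0)) N) (mean k (exp (ln X1)) N).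
    by rewrite !E; [rewrite Rmin_left ?Rmax_right; lra | rewrite /X1; lra | lra].
  have [u [Hu Eu]] := IVT_gen (fun u => mean k (exp u) N) _ _ _ Hc Hv.
  exists (exp u); split=> //.
  rewrite -(E X0) //; rewrite Rmin_left // in Hu.
  case: (proj1 Hu) => [H|->]; last by right.
  by left; apply: exp_increasing.
Qed.

(** Otherwise all [n + 1] terms would be at least [X^k / 4 >= (n + 1) / 4], and [(n + 1)^2 / 4 > n]
    for [n >= 2]. So the cut at [n + 1] keeps all the dominant terms. *)
Lemma saddle_lt (k n : nat) (X : R) : (1 <= k)%nat -> (2 <= n)%nat -> 1 <= X ->
  mean k X (n + 1) = INR n -> X < INR (n + 1).
Proof.
  move=> Hk Hn HX Em; apply: Rnot_le_lt => H.
  have := mean_ge k X Hk HX (n + 1) (n + 1) ltac:(lia) H; rewrite Em.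
  have := Rle_pow X 1 k HX Hk; rewrite pow_1.
  have := le_INR 2 n Hn; rewrite [INR 2]/= in H *.
  rewrite plus_INR [INR 1]/= in H *; nra.
Qed.

Lemma saddle_size (k n N : nat) (X : R) : (1 <= k)%nat -> 2 <= X -> X < INR N ->
  mean k X N = INR n -> X * X ^ k / 8 <= INR n.
Proof.
  move=> Hk HX HN Em.
  have [M [HM1 HM2]] := nfloor_ex X ltac:(lra).
  have HMN : (M <= N)%nat by apply: INR_le; lra.
  have := mean_ge k X Hk ltac:(lra) N M HMN HM1; rewrite Em.
  have := Xk_gt0 k X ltac:(lra); nra.
Qed.

(** The addition formula for cosine; [s = 1] and [s = -1] treat [n + 1] and [n - 1] together. *)
Lemma RInt_shift_cos (A psi : R -> R) (s : R) : s ^ 2 = 1 ->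
  (forall t, continuous A t) -> (forall t, continuous psi t) ->
  RInt (fun t => A t * cos (psi t - s * t)) (- PI) PI =
    int_cos A psi - int_var A psi + s * int_sin A psi.
Proof.
  move=> Hs HA Hpsi.
  have ex (f : R -> R) : (forall t, continuous f t) -> is_RInt f (- PI) PI (RInt f (- PI) PI).
    by move=> H; apply: RInt_correct; apply: ex_RInt_continuous => t _.
  have I1 := ex _ (cos_psi_continuous A psi HA Hpsi).
  have I2 := ex _ (var_continuous A psi HA Hpsi).
  have I3 := ex _ (sin_psi_continuous A psi HA Hpsi).
  have I := is_RInt_plus _ _ _ _ _ _ (is_RInt_minus _ _ _ _ _ _ I1 I2) (is_RInt_scal _ _ _ s _ I3).
  apply: is_RInt_unique; apply: is_RInt_ext I => t _.
  rewrite /plus /minus /opp /scal /= /mult /plus /=.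
  have Hst : cos (s * t) = cos t /\ sin (s * t) = s * sin t.
    have : (s - 1) * (s + 1) = 0 by ring_simplify; lra.
    case/Rmult_integral => E.
      have -> : s = 1 by lra.
      by rewrite !Rmult_1_l.
    have -> : s = -1 by lra.
    have -> : -1 * t = - t by ring.
    by rewrite cos_neg sin_neg; split=> //; ring.
  have [E1 E2] := Hst; rewrite cos_minus E1 E2; ring.
Qed.

Lemma rprod_gt0 (f : nat -> R) (N : nat) :
  (forall m, (1 <= m)%nat -> 0 < f m) -> 0 < rprod f N.
Proof.
  move=> H; elim: N => [|N IH] /=; first lra.
  by apply: Rmult_lt_0_compat => //; apply: H; lia.
Qed.

(** * Choice of the parameters and assembly *)

Section PowerPartitions.

Variables (k : nat) (p : nat -> Z -> R).
Hypotheses (k_ge1 : (1 <= k)%nat)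
  (p0 : forall z, p 0%nat z = if (z =? 0)%Z then 1 else 0)
  (pS : forall N z, p (S N) z = p N z + p (S N) (z - Z.of_nat (S N ^ k))%Z)
  (p_neg : forall N z, (z < 0)%Z -> p N z = 0).

(* [X = Z^6], so that the widths [eta = x / (25 X^(1/3))] and [zeta = x / X^(1/2)] involve only
   integral powers of [Z]. *)
Lemma inequalities_at_saddle (Z c kappa : R) (n N : nat) :
  kappa = exp (-12500) -> 25 + 1000 / kappa <= Z -> 1 < INR n ->
  mean k (Z ^ 6) N = INR n -> Z ^ 6 * (Z ^ 6) ^ k / 8 <= INR n ->
  (forall t, / (25 * Z ^ 2 * (Z ^ 6) ^ k) <= Rabs t <= PI ->
    amplitude (fun m => (m ^ k)%nat) (/ (Z ^ 6) ^ k) N t <= exp (- (c * Z ^ 2))) ->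
  exp (- (c * Z ^ 2)) <= kappa / 3072 / Z ^ (9 + 18 * k) ->
  let P z := p N (Z.of_nat n + z)%Z in
  2 * P 0%Z * INR n ^ 2 < (P 1%Z + P (-1)%Z) * (INR n ^ 2 - 1) /\
  P 1%Z * P (-1)%Z * (INR n ^ 2 + 1) < P 0%Z ^ 2 * INR n ^ 2.
Proof.
  move=> Ek HZ Hn1 Em Hn Htail HT P.
  have Hk0 : 0 < kappa by rewrite Ek; apply: exp_pos.
  have Hk1 : kappa <= 1.
    by rewrite Ek -exp_0; left; apply: exp_increasing; lra.
  have HkZ : 1000 < kappa * Z.
    have : kappa * (25 + 1000 / kappa) <= kappa * Z by apply: Rmult_le_compat_l; lra.
    have -> : kappa * (25 + 1000 / kappa) = 25 * kappa + 1000 by field; lra.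
    lra.
  have HZ25 : 25 <= Z.
    have : 0 < 1000 / kappa by apply: Rdiv_lt_0_compat; lra.
    lra.
  have HZ6 : Z <= Z ^ 6 by rewrite -{1}[Z]pow_1; apply: Rle_pow; [lra | lia].
  (* This is [24 T <= kappa * zeta^3 / 128], with [3072 = 24 * 128]. *)
  have HT' : exp (- (c * Z ^ 2)) <= kappa / 3072 * (/ (Z ^ 3 * (Z ^ 6) ^ k)) ^ 3.
    apply: Rle_trans HT _; right.
    have -> : Z ^ (9 + 18 * k) = (Z ^ 3 * (Z ^ 6) ^ k) ^ 3.
      rewrite Rpow_mult_distr -!pow_mult -pow_add; congr (_ ^ _); lia.
    by rewrite pow_inv.
  set X := Z ^ 6 in HZ6 Em Hn Htail HT'.
  have HX1 : 1 <= X by lra.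
  have HXk := Xk_gt0 k X HX1.
  have HXk25 : 25 <= X ^ k.
    by have := Rle_pow X 1 k HX1 k_ge1; rewrite pow_1; lra.
  set e := (fun m : nat => (m ^ k)%nat) in Htail.
  set x := / X ^ k in Htail.
  have Hx0 : 0 < x by apply: Rinv_0_lt_compat.
  have Hx : x <= / 25 by apply: Rinv_le_contravar; lra.
  have He : forall m, (1 <= m)%nat -> (1 <= e m)%nat by apply: pow_ge1.
  pose A := amplitude e x N.
  pose psi t := argument e x N t - INR n * t.
  have HA t : continuous A t by apply: amplitude_continuous.
  have Hpsi t : continuous psi t.
    apply: (continuous_minus (argument e x N) (fun t => INR n * t)).
      by apply: argument_continuous.
    exact: (continuous_dilate (fun u => u) (INR n) t (fun u => continuous_id u)).
  set eta := / (25 * Z ^ 2 * X ^ k) in Htail.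
  set zeta := / (Z ^ 3 * X ^ k) in HT'.
  have HZ2 : 625 <= Z ^ 2 by nra.
  have HZ9 : 0 < Z ^ 9 by apply: pow_lt; lra.
  have HZ3 : 25 * Z ^ 2 <= Z ^ 3 by nra.
  have Heta : eta = x / (25 * Z ^ 2) by rewrite /eta /x; field; lra.
  have Hzeta : zeta = x / Z ^ 3 by rewrite /zeta /x; field; lra.
  have Heta0 : 0 < eta by rewrite Heta; apply: Rdiv_lt_0_compat; lra.
  have Hzeta0 : 0 < zeta by rewrite Hzeta; apply: Rdiv_lt_0_compat; lra.
  have Hze : zeta <= eta.
    rewrite Heta Hzeta; apply: Rmult_le_compat_l; first lra.
    by apply: Rinv_le_contravar; lra.
  have Hex : eta <= x / 192.
    rewrite Heta; apply: Rmult_le_compat_l; first lra.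
    by apply: Rinv_le_contravar; lra.
  have Heta1 : eta <= 1 by lra.
  have psi_center t : Rabs t <= eta -> / 2 <= cos (psi t).
    move=> Ht; have := argument_approx k X k_ge1 HX1 N t.
    rewrite -/x -/e Em -/(psi t) => H.
    have H1 : (Rabs t * X ^ k) ^ 3 <= (/ (25 * Z ^ 2)) ^ 3.
      apply: pow_incr; split; first by apply: Rmult_le_pos; [apply: Rabs_pos | lra].
      have -> : / (25 * Z ^ 2) = eta * X ^ k by rewrite /eta; field; lra.
      by apply: Rmult_le_compat_r; lra.
    have H2 : 12500 * X * (Rabs t * X ^ k) ^ 3 <= 12500 * X * (/ (25 * Z ^ 2)) ^ 3.
      by apply: Rmult_le_compat_l; lra.
    (* The 25 in [eta] is chosen for this: [25^3 = 15625 > 12500], so [|psi| < 1] and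
       [cos psi >= 1/2]. *)
    have E3 : 12500 * X * (/ (25 * Z ^ 2)) ^ 3 = 4 / 5 by rewrite /X; field; lra.
    have H4 : (psi t) ^ 2 <= 1.
      rewrite -(pow2_abs (psi t)); have := Rabs_pos (psi t); nra.
    by have := one_minus_cos_le (psi t); lra.
  have A_center t : Rabs t <= zeta -> kappa <= A t.
    move=> Ht; have := amplitude_ge k X k_ge1 HX1 N t; rewrite -/x -/e -/(A t).
    apply: Rle_trans; rewrite Ek.
    have H1 : (t * X ^ k) ^ 2 <= (/ Z ^ 3) ^ 2.
      rewrite -(pow2_abs (t * _)) Rabs_mult (Rabs_pos_eq (X ^ k)); last lra.
      apply: pow_incr; split; first by apply: Rmult_le_pos; [apply: Rabs_pos | lra].
      have -> : / Z ^ 3 = zeta * X ^ k by rewrite /zeta; field; lra.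
      by apply: Rmult_le_compat_r; lra.
    have H2 : 12500 * X * (t * X ^ k) ^ 2 <= 12500 * X * (/ Z ^ 3) ^ 2.
      by apply: Rmult_le_compat_l; lra.
    (* [zeta] is scaled so that the powers of [Z] cancel; this yields the constant
       [kappa = exp (-12500)]. *)
    have E3 : 12500 * X * (/ Z ^ 3) ^ 2 = 12500 by rewrite /X; field; lra.
    have [H|->] : -12500 <= - (12500 * X * (t * X ^ k) ^ 2) by lra.
      by left; apply: exp_increasing.
    by right.
  have HnX : INR n ^ 2 * x ^ 2 >= Z ^ 12 / 64.
    have H1 : Z ^ 6 / 8 <= INR n * x.
      have -> : Z ^ 6 / 8 = X * X ^ k / 8 * x by rewrite /x -/X; field; lra.
      by apply: Rmult_le_compat_r; lra.
    have H2 : (Z ^ 6 / 8) ^ 2 <= (INR n * x) ^ 2.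
      by apply: pow_incr; split=> //; rewrite -/X; apply: Rdiv_le_0_compat; lra.
    have -> : Z ^ 12 / 64 = (Z ^ 6 / 8) ^ 2 by field.
    by rewrite -Rpow_mult_distr; lra.
  have HZ12 : Z <= Z ^ 12 / 64 * / Z.
    have : 1 <= Z ^ 8 by apply: pow_R1_Rle; lra.
    have -> : Z ^ 12 / 64 * / Z = Z ^ 8 * (Z ^ 2) * (Z / 64) by field; lra.
    move=> H8.
    have : 1 * 625 <= Z ^ 8 * Z ^ 2 by apply: Rmult_le_compat; lra.
    move: (Z ^ 8 * Z ^ 2) => w Hw; nra.
  have Hcond : 3 * 128 * eta < INR n ^ 2 * (kappa * zeta ^ 3).
    have -> : INR n ^ 2 * (kappa * zeta ^ 3) = INR n ^ 2 * x ^ 2 * (kappa * x / Z ^ 9).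
      by rewrite Hzeta; field; lra.
    apply: (Rlt_le_trans _ (Z ^ 12 / 64 * (kappa * x / Z ^ 9))).
      have -> : Z ^ 12 / 64 * (kappa * x / Z ^ 9) = x / Z ^ 2 * (kappa * Z * Z ^ 4 / 64).
        by field; lra.
      have -> : 3 * 128 * eta = x / Z ^ 2 * (384 / 25) by rewrite Heta; field; lra.
      apply: Rmult_lt_compat_l; first by apply: Rdiv_lt_0_compat; lra.
      (* With [kappa * Z > 1000] it is enough that [1000 / 64 = 15.625] exceeds
         [384 / 25 = 15.36]. *)
      have : 1 <= Z ^ 4 by apply: pow_R1_Rle; lra.
      move: (kappa * Z) (Z ^ 4) HkZ => u v Hu Hv; nra.
    apply: Rmult_le_compat_r; last lra.
    apply: Rdiv_le_0_compat; first by apply: Rmult_le_pos; lra.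
    by apply: pow_lt; lra.
  have [Ia [Ib [Is Iab]]] := saddle_integrals A psi eta zeta kappa (exp (- (c * Z ^ 2)))
    HA Hpsi (amplitude_bounds e x He Hx0 N) (conj Hzeta0 Hze) Heta1 Hk0
    (Rlt_le _ _ (exp_pos _)) psi_center Htail A_center x (INR n) Hk1 Hex ltac:(lra) Hcond.
  set Q := rprod (fun m => 1 - boltz e x m) N.
  have HQ : 0 < Q.
    by apply: rprod_gt0 => m Hm; have := boltz_bounds e x m (He m Hm) Hx0; lra.
  have HPI := PI_RGT_0.
  have four z : RInt (fun t => A t * cos (psi t - IZR z * t)) (- PI) PI =
      2 * PI * (P z * exp (- ((INR n + IZR z) * x)) * Q).
    have F := fourier_inversion e x He Hx0 p p0 pS p_neg N (Z.of_nat n + z).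
    rewrite plus_IZR -INR_IZR_INZ in F; rewrite -[RHS]F.
    by apply: RInt_ext => t _; rewrite /integrand /psi; congr (_ * cos _); ring.
  apply: (inequalities_of_integrals (2 * PI * Q * exp (- (INR n * x))) x (INR n)
    (P 0%Z) (P 1%Z) (P (-1)%Z) (int_cos A psi) (int_var A psi) (int_sin A psi)) => //.
  - apply: Rmult_lt_0_compat; last exact: exp_pos.
    by apply: Rmult_lt_0_compat => //; lra.
  - lra.
  - have := Rmult_le_compat_r Z _ _ ltac:(lra) HZ12.
    have -> : Z ^ 12 / 64 * / Z * Z = Z ^ 12 / 64 by field; lra.
    lra.
  - have := four 0%Z; rewrite Rplus_0_r => F.
    transitivity (2 * PI * (P 0%Z * exp (- (INR n * x)) * Q)); first ring.
    rewrite -F; apply: RInt_ext => t _; congr (_ * cos _); ring.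
  - have := four 1%Z; rewrite RInt_shift_cos //; last ring.
    have -> : exp (- ((INR n + 1) * x)) = exp (- (INR n * x)) * / exp x.
      by rewrite -exp_Ropp -exp_plus; congr exp; ring.
    rewrite Rmult_1_l => ->; field.
    by have := exp_pos x; lra.
  - have := four (-1)%Z; rewrite RInt_shift_cos //; last ring.
    have -> : exp (- ((INR n + -1) * x)) = exp (- (INR n * x)) * / exp (- x).
      by rewrite -exp_Ropp -exp_plus; congr exp; ring.
    have -> : int_cos A psi - int_var A psi + -1 * int_sin A psi =
      int_cos A psi - int_var A psi - int_sin A psi by ring.
    move=> ->; field.
    by have := exp_pos (- x); lra.
Qed.

(** For large [n] the upper bound [mean_le] at [Z0 ^ 6] is below [n], so the saddle point can be
    taken beyond that threshold, where all the estimates hold. *)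
Lemma eventually_inequalities : exists n0 : nat, forall n : nat, (n0 <= n)%nat ->
  let P z := p (n + 1) (Z.of_nat n + z)%Z in
  2 * P 0%Z * INR n ^ 2 < (P 1%Z + P (-1)%Z) * (INR n ^ 2 - 1) /\
  P 1%Z * P (-1)%Z * (INR n ^ 2 + 1) < P 0%Z ^ 2 * INR n ^ 2.
Proof.
  have [c [Z1 [Hc [HZ1 Htail]]]] := amplitude_tail k k_ge1.
  pose kappa := exp (-12500).
  have Hk0 : 0 < kappa by apply: exp_pos.
  have [Z2 [HZ2 Hexp]] := exp_neg_sq_le_inv_pow c (kappa / 3072) (9 + 18 * k) Hc ltac:(lra).
  have Hk3 : 0 < 1000 / kappa by apply: Rdiv_lt_0_compat; lra.
  pose Z0 := Z1 + Z2 + 25 + 1000 / kappa.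
  have HZ0 : 1 <= Z0 by rewrite /Z0; lra.
  have HX0 : 1 <= Z0 ^ 6 by apply: pow_R1_Rle.
  have [n1 Hn1] := INR_unbounded (12500 * Z0 ^ 6 * (Z0 ^ 6) ^ k).
  exists (n1 + 2)%nat => n Hn.
  have Hmean : mean k (Z0 ^ 6) (n + 1) <= INR n.
    have := mean_le k (Z0 ^ 6) k_ge1 HX0 (n + 1); have := le_INR n1 n ltac:(lia); lra.
  have [X [HX Em]] := exists_saddle_point k (n + 1) n (Z0 ^ 6) k_ge1 ltac:(lia) HX0 Hmean.
  pose Z := exp (ln X / 6).
  have EX : Z ^ 6 = X.
    rewrite -Rpower_pow; last exact: exp_pos.
    rewrite /Rpower /Z ln_exp.
    have -> : INR 6 * (ln X / 6) = ln X by rewrite [INR 6]/=; field.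
    by apply: exp_ln; lra.
  have HZ : Z0 <= Z.
    apply: Rnot_lt_le => H.
    have := pow_lt_compat Z Z0 6 ltac:(lia) (conj (Rlt_le _ _ (exp_pos _)) H).
    by rewrite EX; lra.
  have HXN := saddle_lt k n X k_ge1 ltac:(lia) ltac:(lra) Em.
  have HZ6 : Z <= Z ^ 6 by rewrite -{1}[Z]pow_1; apply: Rle_pow; [lra | lia].
  have HX2 : 2 <= X by rewrite -EX; rewrite /Z0 in HZ; lra.
  apply: (inequalities_at_saddle Z c kappa n (n + 1)) => //.
  - rewrite /Z0 in HZ; lra.
  - have := lt_INR 1 n ltac:(lia); by rewrite [INR 1]/=.
  - by rewrite EX.
  - by rewrite EX; apply: (saddle_size k n (n + 1)).
  - move=> t Ht; apply: Htail => //; first by rewrite /Z0 in HZ; lra.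
    by rewrite EX; lra.
  - by apply: Hexp; rewrite /Z0 in HZ; lra.
Qed.

End PowerPartitions.

(** Both inequalities are multiplied by [n^2], and the subtracted term is moved to the left to avoid
    truncated subtraction. *)
Lemma eventually_inequalities_nat (k : nat) (P : nat -> nat -> nat) : (1 <= k)%nat ->
  (forall n, P 0%nat n = if (n =? 0)%nat then 1%nat else 0%nat) ->
  (forall N n, P (S N) n =
    (P N n + if (S N ^ k <=? n)%nat then P (S N) (n - S N ^ k)%nat else 0)%nat) ->
  exists n0 : nat, forall n : nat, (n0 <= n)%nat ->
  (2 * P (S n) n * (n * n) + (P (S n) (S n) + P (S n) (pred n)) <
     (P (S n) (S n) + P (S n) (pred n)) * (n * n))%nat /\
  (P (S n) (S n) * P (S n) (pred n) * (n * n + 1) < P (S n) n * P (S n) n * (n * n))%nat.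
Proof.
  move=> Hk HP0 HPS.
  pose p N z := if (z <? 0)%Z then 0 else INR (P N (Z.to_nat z)).
  have p0 z : p 0%nat z = if (z =? 0)%Z then 1 else 0.
    rewrite /p HP0; case: Z.ltb_spec => H1; case: Z.eqb_spec => H2; try lia; try done.
      by rewrite H2.
    by case: Nat.eqb_spec => H3 //; lia.
  have p_neg N z : (z < 0)%Z -> p N z = 0 by rewrite /p => /Z.ltb_lt ->.
  have pS N z : p (S N) z = p N z + p (S N) (z - Z.of_nat (S N ^ k))%Z.
    have He := pow_ge1 k (S N) ltac:(lia); move: (S N ^ k)%nat (HPS N) He => e HS He.
    rewrite /p; case: Z.ltb_spec => H1; case: Z.ltb_spec => H2; try lia; try lra.
      by rewrite HS; case: Nat.leb_spec => H3; [lia | rewrite plus_INR].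
    rewrite HS; case: Nat.leb_spec => H3; last lia.
    by rewrite plus_INR; congr (_ + INR (P _ _)); lia.
  have [n0 Hn0] := eventually_inequalities k p Hk p0 pS p_neg.
  (* The successor ensures [n >= 1], so that [pred n] is the true [n - 1]. *)
  exists (S n0) => n Hn; have [] := Hn0 n ltac:(lia).
  have -> : (n + 1 = S n)%nat by lia.
  have E z : (0 <= Z.of_nat n + z)%Z ->
      p (S n) (Z.of_nat n + z)%Z = INR (P (S n) (Z.to_nat (Z.of_nat n + z))).
    by rewrite /p => /Z.ltb_ge ->.
  rewrite !E; try lia.
  have -> : Z.to_nat (Z.of_nat n + 0) = n by lia.
  have -> : Z.to_nat (Z.of_nat n + 1) = S n by lia.
  have -> : Z.to_nat (Z.of_nat n + -1) = pred n by lia.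
  move: (P (S n) n) (P (S n) (S n)) (P (S n) (pred n)) => a b c H1 H2.
  have I1 : INR 1 = 1 by [].
  have I2 : INR 2 = 2 by [].
  by split; apply: INR_lt; rewrite !(plus_INR, mult_INR) ?I1 ?I2; lra.
Qed.

(** * Enumeration of partitions into powers *)

Require Import Defs.
From mathcomp Require Import all_boot all_order all_algebra.

Import Order.TTheory GRing.Theory Num.Theory.

Local Close Scope R_scope.
Local Open Scope nat_scope.

Definition power_upto (k N a : nat) : bool := [exists m : 'I_N.+1, (0 < m) && (m ^ k == a)].

Lemma power_uptoP (k N a : nat) :
  reflect (exists2 m, 0 < m <= N & a = m ^ k) (power_upto k N a).
Proof.
apply: (iffP existsP) => [[m /andP[m0 /eqP <-]]|[m /andP[m0 mN] ->]].
  by exists (m : nat); rewrite // m0 -ltnS ltn_ord.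
by exists (Ordinal (mN : m < N.+1)); rewrite /= m0 eqxx.
Qed.

Definition bounded_power_partition (k N n : nat) (s : seq nat) : bool :=
  [&& sorted geq s, all (power_upto k N) s & sumn s == n].

(* Complete as soon as [N + n < fuel]. *)
Fixpoint power_partitions (k fuel N n : nat) : seq (seq nat) :=
  if fuel isn't d.+1 then [::] else
  if N isn't N'.+1 then if n == 0 then [:: [::]] else [::] else
  power_partitions k d N' n ++
    (if N ^ k <= n then map (cons (N ^ k)) (power_partitions k d N (n - N ^ k)) else [::]).

Lemma power_partitionsS (k d N n : nat) : power_partitions k d.+1 N.+1 n =
  power_partitions k d N n ++
    (if N.+1 ^ k <= n then map (cons (N.+1 ^ k)) (power_partitions k d N.+1 (n - N.+1 ^ k))
     else [::]).
Proof. by []. Qed.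

Lemma power_partitions_fuel (k d d' N n : nat) : N + n < d -> N + n < d' ->
  power_partitions k d N n = power_partitions k d' N n.
Proof.
elim: d d' N n => [//|d IH] [//|d'] [//|N] n lt lt' /=.
congr (_ ++ _); first by apply: IH; rewrite -ltnS.
case: ifP => // le; have pos : 0 < N.+1 ^ k by rewrite expn_gt0.
have lt2 : n - N.+1 ^ k < n by rewrite ltn_subrL pos (leq_trans pos le).
congr map; apply: IH.
  by rewrite -ltnS; apply: leq_trans lt; rewrite ltnS ltn_add2l.
by rewrite -ltnS; apply: leq_trans lt'; rewrite ltnS ltn_add2l.
Qed.

(** In a nonincreasing list the largest admissible part [N.+1 ^ k] occurs only if it is the head;
    [power_partitions] branches in the same way. *)
Lemma bounded_power_partitionS (k N n : nat) (s : seq nat) : 0 < k ->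
  bounded_power_partition k N.+1 n s = bounded_power_partition k N n s ||
    [&& N.+1 ^ k <= n, head 0 s == N.+1 ^ k &
        bounded_power_partition k N.+1 (n - N.+1 ^ k) (behead s)].
Proof.
move=> k0; have pos : 0 < N.+1 ^ k by rewrite expn_gt0.
case: s => [|a s]; rewrite /bounded_power_partition /=.
  by rewrite (ltn_eqF pos) andbF orbF.
have geq_trans : transitive geq by move=> x y z xy yz; apply: leq_trans yz xy.
rewrite (path_sortedE geq_trans).
have upS b : power_upto k N b -> power_upto k N.+1 b.
  by case/power_uptoP=> m /andP[m0 mN] ->; apply/power_uptoP; exists m; rewrite // m0 leqW.
have up_lt b : power_upto k N b -> b < N.+1 ^ k.
  by case/power_uptoP=> m /andP[m0 mN] ->; rewrite ltn_exp2r.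
have up_le b : power_upto k N.+1 b -> b <= N.+1 ^ k.
  by case/power_uptoP=> m /andP[m0 mN] ->; rewrite leq_exp2r.
have upI b : power_upto k N.+1 b -> b < N.+1 ^ k -> power_upto k N b.
  case/power_uptoP=> m /andP[m0 mN] ->; rewrite ltn_exp2r // ltnS => mN'.
  by apply/power_uptoP; exists m; rewrite // m0.
have [-> | ne] := eqVneq a (N.+1 ^ k).
  have -> : power_upto k N (N.+1 ^ k) = false by apply/negbTE/negP=> /up_lt; rewrite ltnn.
  have -> : power_upto k N.+1 (N.+1 ^ k) by apply/power_uptoP; exists N.+1; rewrite /= ?leqnn.
  rewrite andbF /=.
  have [le | gt] := leqP (N.+1 ^ k) n; last first.
    by rewrite [_ == n]gtn_eqF ?andbF //; apply: leq_trans gt (leq_addr _ _).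
  have -> : (N.+1 ^ k + sumn s == n) = (sumn s == n - N.+1 ^ k).
    by rewrite -{1}(subnKC le) eqn_add2l.
  have [al | _] := boolP (all (power_upto k N.+1) s); last by rewrite !andbF.
  have -> : all (geq (N.+1 ^ k)) s by apply: sub_all al.
  by [].
rewrite andbF orbF.
have [/andP[ge _] | _] := boolP (all (geq a) s && sorted geq s); last by [].
congr (_ && _); congr (_ && _); apply/andP/andP => -[upa ups].
  have lta : a < N.+1 ^ k by rewrite ltn_neqAle ne up_le.
  split; first exact: upI.
  apply/allP => b bs; apply: upI; first exact: (allP ups).
  exact: leq_ltn_trans (allP ge b bs) lta.
by split; [apply: upS | apply: sub_all ups].
Qed.

Lemma power_partitionsP (k d N n : nat) : 0 < k -> N + n < d ->
  uniq (power_partitions k d N n) /\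
  power_partitions k d N n =i bounded_power_partition k N n.
Proof.
move=> k0; elim: d N n => [//|d IH] [|N] n lt /=.
  have up0 a : power_upto k 0 a = false.
    by apply/power_uptoP => -[m /andP[m0 m0']]; rewrite leqNgt m0 in m0'.
  have [-> | n0] := eqVneq n 0; split=> // -[|a s]; rewrite /in_mem /= /bounded_power_partition /=.
  - by [].
  - by rewrite up0 andbF.
  - by rewrite eq_sym (negbTE n0).
  - by rewrite up0 andbF.
have pos : 0 < N.+1 ^ k by rewrite expn_gt0.
have [U1 M1] := IH N n lt.
have inj : injective (cons (N.+1 ^ k)) by move=> s t [].
have part2 : N.+1 ^ k <= n ->
    uniq (power_partitions k d N.+1 (n - N.+1 ^ k)) /\
    power_partitions k d N.+1 (n - N.+1 ^ k) =i
      bounded_power_partition k N.+1 (n - N.+1 ^ k).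
  move=> le; apply: IH; rewrite -ltnS; apply: leq_trans lt.
  by rewrite ltnS ltn_add2l ltn_subrL pos (leq_trans pos le).
have memS s : (s \in (if N.+1 ^ k <= n then
      map (cons (N.+1 ^ k)) (power_partitions k d N.+1 (n - N.+1 ^ k)) else [::])) =
    [&& N.+1 ^ k <= n, head 0 s == N.+1 ^ k &
        bounded_power_partition k N.+1 (n - N.+1 ^ k) (behead s)].
  case: ifP => // le; have [U2 M2] := part2 le.
  case: s => [|a s] /=.
    by rewrite (ltn_eqF pos) /=; apply/mapP => -[].
  apply/mapP/andP => [[t tin [-> ->]]|[/eqP -> ps]].
    by rewrite eqxx; split=> //; rewrite M2 in tin.
  by exists s; rewrite ?M2.
split.
  rewrite cat_uniq U1 /=; apply/andP; split; last first.
    by case: ifP => // le; have [U2 _] := part2 le; rewrite map_inj_uniq.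
  apply/hasPn => s; rewrite memS => /and3P[_ /eqP hs _]; rewrite M1.
  apply/negP; case: s hs => [|a s] /=; first by move/eqP; rewrite (ltn_eqF pos).
  move=> -> /and3P[_ /=/andP[/power_uptoP[m /andP[m0 mN] /eqP]]].
  by rewrite eqn_exp2r // => /eqP E; rewrite -E ltnn in mN.
by move=> s; rewrite mem_cat memS M1 -[RHS]/(bounded_power_partition _ _ _ s) [RHS]bounded_power_partitionS.
Qed.

(** A part [m ^ k <= n] has [m <= n <= N], so the bound on the bases excludes nothing. Hence one [N]
    serves [n - 1], [n] and [n + 1]. *)
Lemma num_power_partitions_bounded (k N n : nat) : 0 < k -> n <= N ->
  num_power_partitions k n = size (power_partitions k (N + n).+1 N n).
Proof.
move=> k0 nN; have [U M] := power_partitionsP k (N + n).+1 N n k0 (leqnn _).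
apply: num_power_partitionsE => // s; rewrite M -[LHS]/(bounded_power_partition k N n s).
rewrite /bounded_power_partition /is_power_partition /is_partition.
have [_ | _] := boolP (sorted geq s) => //=.
have [/eqP sn | _] := boolP (sumn s == n); last by rewrite !andbF.
rewrite !andbT.
have les a : a \in s -> a <= n.
  rewrite -sn; elim: s {sn M U} => //= b s IH; rewrite inE => /orP[/eqP -> | /IH le].
    exact: leq_addr.
  exact: leq_trans le (leq_addl _ _).
apply/allP/andP => [H | [_ /allP H] a as_].
  split; apply/allP => a /H /power_uptoP[m /andP[m0 _] ->]; first by rewrite expn_gt0 m0.
  by apply/is_pos_powerP => //; exists m.
have /(is_pos_powerP _ k0) [m m0 am] := H a as_.
apply/power_uptoP; exists m => //; rewrite m0; apply: leq_trans nN.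
apply: leq_trans (les a as_); rewrite am.
by rewrite -{1}(expn1 m) leq_pexp2l.
Qed.

Lemma Nat_powE (m k : nat) : Nat.pow m k = m ^ k.
Proof. by elim: k => [//|k IH]; rewrite expnS -IH. Qed.

Lemma power_partitions_inequalities (k : nat) : 0 < k ->
  exists n0 : nat, forall n : nat, n0 <= n ->
  let p := num_power_partitions k in
  2 * p n * (n * n) + (p n.+1 + p n.-1) < (p n.+1 + p n.-1) * (n * n) /\
  p n.+1 * p n.-1 * (n * n + 1) < p n * p n * (n * n).
Proof.
move=> k0; pose P N n := size (power_partitions k (N + n).+1 N n).
have P0 n : P 0 n = if Nat.eqb n 0 then 1 else 0 by case: n.
have PS N n : P N.+1 n = P N n + if Nat.leb (Nat.pow N.+1 k) n
    then P N.+1 (n - Nat.pow N.+1 k) else 0.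
  rewrite Nat_powE /P power_partitionsS size_cat; congr (size _ + _).
  have pos : 0 < N.+1 ^ k by rewrite expn_gt0.
  have -> : Nat.leb (N.+1 ^ k) n = (N.+1 ^ k <= n).
    by apply/idP/idP => [/PeanoNat.Nat.leb_le/ssrnat.leP | /ssrnat.leP/PeanoNat.Nat.leb_le].
  case: ifP => // le; rewrite size_map.
  (* The recursive call inherits more fuel than [P] assigns to the smaller argument. *)
  congr size; apply: power_partitions_fuel; last by [].
  by rewrite addSn ltnS -addnS leq_add2l ltn_subrL pos (leq_trans pos le).
have k1 : (1 <= k)%coq_nat by apply/ssrnat.leP.
have [n0 H] := eventually_inequalities_nat k P k1 P0 PS.
exists n0 => n /ssrnat.leP /H [H1 H2] p.
rewrite /p !(@num_power_partitions_bounded k n.+1) ?leqnSn ?(leq_trans (leq_pred n)) //.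
by split; apply/ssrnat.ltP.
Qed.

(** * The inequalities over the rationals *)

Local Open Scope ring_scope.

Theorem theorem1p3 (k : nat) (hk : (0 < k)%N) :
  exists C D : nat,
    [/\ (0 < C)%N, (0 < D)%N,
      forall n : nat, (C <= n)%N ->
        2 * (num_power_partitions k n)%:R <
          ((num_power_partitions k n.+1)%:R + (num_power_partitions k n.-1)%:R)
            * (1 - n%:R ^- 2) :> rat
    & forall n : nat, (D <= n)%N ->
        (num_power_partitions k n)%:R ^+ 2 >
          (num_power_partitions k n.+1)%:R * (num_power_partitions k n.-1)%:R
            * (1 + n%:R ^- 2) :> rat].
Proof.
have [n0 H] := power_partitions_inequalities k hk.
(* The successor makes [n] positive, so [n%:R ^- 2] is a genuine inverse and multiplication by
   [n ^ 2] clears it. *)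
exists n0.+1, n0.+1; split=> // n n0n; have [H1 H2] := H n (ltnW n0n).
  have np : 0 < n%:R ^+ 2 :> rat by rewrite exprn_gt0 // ltr0n (leq_trans _ n0n).
  rewrite -(ltr_pM2r np) -[ltRHS]mulrA mulrBl mul1r mulVf ?gt_eqF // mulrBr mulr1 ltrBrDr.
  by rewrite -natrX -!natrD -!natrM -natrD ltr_nat -mulnn.
have np : 0 < n%:R ^+ 2 :> rat by rewrite exprn_gt0 // ltr0n (leq_trans _ n0n).
rewrite -(ltr_pM2r np) -[ltLHS]mulrA mulrDl mul1r mulVf ?gt_eqF //.
by rewrite -!natrX -(natrD _ _ 1) -!natrM ltr_nat -!mulnn.
Qed.
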